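(* Consider the inexact proximal method described in the context with $\delta_k=\frac{c}{k^s}$ for fixed constants $c>0$, $s>1$, where each outer step $k\ge0$ is carried out by running the inner method for $\Phi_{k+1}$ from $z_0=x_k$ until the first $t\ge0$ with $\|\Phi'_{k+1}(z_t)\|_*\le\delta_{k+1}$, and then setting $x_{k+1}=z_t$, $g_{k+1}=\Phi'_{k+1}(z_t)$. Assume $F'(x_i)\neq0$ for all iterates. Let $N_k$ denote the total number of inner steps (oracle calls) performed during the first $k$ outer iterations. Let $$R=\|x_0-x^*\|+\frac{cs}{s-1},\qquad D=\max\Big\{R,\Big(\frac{p!\,\|F'(x_0)\|_*}{(p+1)L_p2^{p-1}}\Big)^{1/p}\Big\}.$$ Let $\varepsilon>0$ and $K$ be such that $F(x_k)-F^*\ge\varepsilon$ for $1\le k\le K$. Then for every $k$ with $\ln\frac{\|F'(x_0)\|_*R}{\varepsilon}\le k\le K$, $$F(\bar x_k)-F^*\le\frac{L_pR^{p+1}}{k^{\frac{p+1}{2}}}\cdot\frac{(p+1)2^{p-2}\exp(p-1)}{p!},$$ where $\bar x_k=\frac{\sum_{i=1}^ka_ix_i}{\sum_{i=1}^ka_i}$. Moreover, $$N_k\le k\Big(1+\frac{1}{\log_2p}\log_2\log_2\frac{2Dk^s}{c}\Big).$$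
   Context: $\mathbb{E}$ is a finite-dimensional real vector space with dual $\mathbb{E}^*$; $B:\mathbb{E}\to\mathbb{E}^*$ is a fixed self-adjoint positive-definite operator, $\|x\|=\langle Bx,x\rangle^{1/2}$, $\|g\|_*=\langle g,B^{-1}g\rangle^{1/2}$. Let $p\ge 2$ be an integer, $h:\mathbb{E}\to\mathbb{R}\cup\{+\infty\}$ proper closed convex, and $f$ convex and $p$ times differentiable on an open convex set containing $\operatorname{dom}h$, with $\|D^pf(x)-D^pf(y)\|\le L_p\|x-y\|$ for $x,y\in\operatorname{dom}h$, $0<L_p<\infty$, where for a symmetric $p$-linear form $\|A\|=\max_{\|u\|\le1}|A[u]^p|$. $F=f+h$, attaining its minimum $F^*$ at $x^*\in\operatorname{dom}h$. Taylor polynomial $\Omega_p(f,x;y)=f(x)+\sum_{k=1}^p\frac1{k!}D^kf(x)[y-x]^k$, with gradient in $y$: $\nabla\Omega_p(f,x;y)=\sum_{k=1}^p\frac1{(k-1)!}D^kf(x)[y-x]^{k-1}$. Inexact proximal method: given $x_0\in\operatorname{dom}h$, a fixed subgradient $F'(x_0)\in\partial F(x_0)$, and accuracies $\delta_k>0$. For $k\ge0$: $a_{k+1}=\big(\frac{1}{2\|F'(x_k)\|_*}\big)^{\frac{p-1}{p}}\big(\frac{p!}{(p+1)L_p}\big)^{1/p}$, $\Phi_{k+1}(x)=a_{k+1}F(x)+\frac12\|x-x_k\|^2$; the step produces $x_{k+1}$ and $g_{k+1}\in\partial\Phi_{k+1}(x_{k+1})$ with $\|g_{k+1}\|_*\le\delta_{k+1}$,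 and $F'(x_{k+1})=\frac{1}{a_{k+1}}(g_{k+1}-B(x_{k+1}-x_k))$. Inner method (RCTM for $\Phi_{k+1}$), one oracle call per step: with $H=a_{k+1}pL_p$, $z_{t+1}=\arg\min_{y\in\mathbb{E}}\{a_{k+1}\Omega_p(f,z_t;y)+\frac{H}{(p+1)!}\|y-z_t\|^{p+1}+a_{k+1}h(y)+\frac12\|y-x_k\|^2\}$; $\Phi'_{k+1}(z_0)=a_{k+1}F'(x_k)$ and $\Phi'_{k+1}(z_{t+1})=a_{k+1}\nabla f(z_{t+1})-a_{k+1}\nabla\Omega_p(f,z_t;z_{t+1})-\frac{H}{p!}\|z_{t+1}-z_t\|^{p-1}B(z_{t+1}-z_t)\in\partial\Phi_{k+1}(z_{t+1})$. *)

(* Defs.v *)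
From HB Require Import structures.
From mathcomp Require Import all_boot all_order all_algebra.
From mathcomp Require Import all_classical all_reals all_analysis.
Set Implicit Arguments.
Unset Strict Implicit.
Unset Printing Implicit Defensive.
Import Order.TTheory GRing.Theory Num.Theory.
Import numFieldNormedType.Exports.
Local Open Scope classical_set_scope.
Local Open Scope ring_scope.

(* The space E is modelled as row vectors 'rV[R]_n; its dual E-dual is also
   'rV[R]_n with the pairing <g, x> = g *m x^T.  B : E -> E-dual is x |-> x *m B. *)

Definition pairing (R : realType) (n : nat) (g x : 'rV[R]_n) : R := (g *m x^T) 0 0.

Definition posdef (R : realType) (n : nat) (B : 'M[R]_n) : Prop :=
  B^T = B /\ forall x : 'rV[R]_n, x != 0 -> 0 < (x *m B *m x^T) 0 0.

Definition normB (R : realType) (n : nat) (B : 'M[R]_n) (x : 'rV[R]_n) : R :=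
  Num.sqrt ((x *m B *m x^T) 0 0).

Definition normBd (R : realType) (n : nat) (B : 'M[R]_n) (g : 'rV[R]_n) : R :=
  Num.sqrt ((g *m invmx B *m g^T) 0 0).

Definition Dk (R : realType) (n : nat) (f : 'rV[R]_n -> R) (u : 'rV[R]_n) (k : nat)
  : 'rV[R]_n -> R :=
  iter k (fun g : 'rV[R]_n -> R => fun y => derive g y u) f.

Definition Dmixed (R : realType) (n : nat) (f : 'rV[R]_n -> R) (u : 'rV[R]_n) (k : nat)
  (v y : 'rV[R]_n) : R :=
  derive (Dk f u k) y v.

(* gradient (as an element of E-dual) : <grad f y, v> = Df(y)[v] *)
Definition grad (R : realType) (n : nat) (f : 'rV[R]_n -> R) (y : 'rV[R]_n) : 'rV[R]_n :=
  \row_i derive f y (delta_mx 0 i).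

Definition taylor (R : realType) (n : nat) (p : nat) (f : 'rV[R]_n -> R) (x y : 'rV[R]_n) : R :=
  f x + \sum_(1 <= k < p.+1) (k`!%:R)^-1 * Dk f (y - x) k x.

Definition taylor_grad (R : realType) (n : nat) (p : nat) (f : 'rV[R]_n -> R)
  (x y : 'rV[R]_n) : 'rV[R]_n :=
  \sum_(1 <= k < p.+1)
     ((k.-1)`!%:R)^-1 *: \row_i Dmixed f (y - x) k.-1 (delta_mx 0 i) x.

(* f is k times (Frechet) differentiable on U (finite dimension: a map into
   the dual is differentiable iff all its directional components are) *)
Fixpoint diffn (R : realType) (n : nat) (k : nat) (U : set 'rV[R]_n)
  (f : 'rV[R]_n -> R) : Prop :=
  match k with
  | 0 => True
  | k'.+1 => (forall y, U y -> differentiable f y) /\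
             (forall v : 'rV[R]_n, diffn k' U (fun y => derive f y v))
  end.

Definition convex_setE (R : realType) (n : nat) (U : set 'rV[R]_n) : Prop :=
  forall (x y : 'rV[R]_n) (t : R), U x -> U y -> 0 <= t <= 1 -> U (t *: x + (1 - t) *: y).

Definition convex_on (R : realType) (n : nat) (U : set 'rV[R]_n) (f : 'rV[R]_n -> R) : Prop :=
  forall (x y : 'rV[R]_n) (t : R), U x -> U y -> 0 <= t <= 1 ->
    f (t *: x + (1 - t) *: y) <= t * f x + (1 - t) * f y.

Definition dom (R : realType) (n : nat) (h : 'rV[R]_n -> \bar R) : set 'rV[R]_n :=
  [set x | (h x < +oo)%E].

Definition proper_fun (R : realType) (n : nat) (h : 'rV[R]_n -> \bar R) : Prop :=
  (forall x, h x != -oo%E) /\ (exists x, (h x < +oo)%E).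

Definition convex_ext (R : realType) (n : nat) (h : 'rV[R]_n -> \bar R) : Prop :=
  forall (x y : 'rV[R]_n) (t : R), 0 <= t <= 1 ->
    (h (t *: x + (1 - t) *: y)%R <= t%:E * h x + (1 - t)%:E * h y)%E.

Definition closed_fun (R : realType) (n : nat) (h : 'rV[R]_n -> \bar R) : Prop :=
  closed [set xa : 'rV[R]_n * R | (h xa.1 <= xa.2%:E)%E].

Definition Fsum (R : realType) (n : nat) (f : 'rV[R]_n -> R) (h : 'rV[R]_n -> \bar R)
  (y : 'rV[R]_n) : \bar R := ((f y)%:E + h y)%E.

Definition subdiff (R : realType) (n : nat) (F : 'rV[R]_n -> \bar R) (x g : 'rV[R]_n) : Prop :=
  forall y, (F x + (pairing g (y - x))%:E <= F y)%E.

(* objective of one RCTM step for Phi_{k+1}, centered at zt, with prox center xk *)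
Definition inner_model (R : realType) (n : nat) (p : nat) (L : R) (B : 'M[R]_n)
  (f : 'rV[R]_n -> R) (h : 'rV[R]_n -> \bar R) (a : R) (xk zt y : 'rV[R]_n) : \bar R :=
  ((a * taylor p f zt y + (a * p%:R * L) / (p.+1)`!%:R * normB B (y - zt) ^+ p.+1
     + 2^-1 * normB B (y - xk) ^+ 2)%:E + a%:E * h y)%E.

(* Phi'_{k+1}(z_t) for the inner sequence z, a = a_{k+1}, Fpk = F'(x_k) *)
Definition inner_grad (R : realType) (n : nat) (p : nat) (L : R) (B : 'M[R]_n)
  (f : 'rV[R]_n -> R) (a : R) (Fpk : 'rV[R]_n) (z : nat -> 'rV[R]_n) (t : nat)
  : 'rV[R]_n :=
  match t with
  | 0 => a *: Fpk
  | t'.+1 => a *: grad f (z t'.+1) - a *: taylor_grad p f (z t') (z t'.+1)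
             - ((a * p%:R * L) / p`!%:R * normB B (z t'.+1 - z t') ^+ p.-1)
               *: ((z t'.+1 - z t') *m B)
  end.

Definition log2 (R : realType) (y : R) : R := ln y / ln 2.

(* Main.v *)
(* Inner method: by Banach's theorem on symmetric multilinear forms, the Lipschitz condition on
   the diagonal of D^p f bounds the full gradient error of the Taylor model by
   L r^p / p!, with r the length of the tensor step. Hence the new gradient is at most
   a (p+1) L r^p / p!, while strong convexity gives r <= |old gradient|; with the chosen a this
   yields gradients below 2 a |F'(x_k)| 2^(-p^t), and log log many steps suffice.
   Outer method: with u = a F'(x_(k+1)), nonexpansiveness of the proximal step gives
   2 a (F(x_(k+1)) - F_star) + |u|^2 + |x_(k+1) - x_star|^2 <= (|x_k - x_star| + delta)^2,
   so all these terms add up to at most R^2. As a_(i+1) is a power of |F'(x_i)|, the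
   arithmetic-geometric inequality (used in logarithmic form) applied to sum a_i^2 |F'(x_i)|^2
   and to sum a_i bounds sum a_i from below. *)

Require Import Defs.
From HB Require Import structures.
From mathcomp Require Import all_boot all_order all_algebra.
From mathcomp Require Import all_classical all_reals all_analysis.
From mathcomp Require Import ring lra.
Set Implicit Arguments.
Unset Strict Implicit.
Unset Printing Implicit Defensive.
Import Order.TTheory GRing.Theory Num.Theory.
Import numFieldNormedType.Exports.
Local Open Scope classical_set_scope.
Local Open Scope ring_scope.

(** * The Euclidean structure defined by B *)

(** The step size is characterised by a^p (2 |F'(x_k)|)^(p-1) = p! / ((p+1) L), the inverse of the
    constant in the inner contraction. This makes 2 a |F'(x_k)| 2^(-p^t) an exact solution of the
    inner recursion, and after taking logarithms it is a linear relation between ln a_(i+1) and ln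
    |F'(x_i)|. The obstacle of the outer analysis is an index shift: a_(i+1) is tied to F'(x_i),
    while the energy controls a_(i+1) |F'(x_(i+1))|. For the rate, the shift telescopes to ln
    |F'(x_0)| - ln |F'(x_k)|, which the lower bound on k keeps below k; this is the origin of
    exp(p-1). For the count, a comparison of consecutive gradients gives a_(i+1) |F'(x_i)| <= D, the
    second entry of D being a_1 |F'(x_0)| itself. Optimality is always tested along segments inside
    [dom h]: the smooth part is differentiated at the left end only, and h enters through
    convexity. *)

Definition ip (R : realType) (n : nat) (B : 'M[R]_n) (x y : 'rV[R]_n) : R :=
  (x *m B *m y^T) 0 0.

Lemma ipDl (R : realType) n (B : 'M[R]_n) x y w : ip B (x + y) w = ip B x w + ip B y w.
Proof. by rewrite /ip !mulmxDl mxE. Qed.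

Lemma ipDr (R : realType) n (B : 'M[R]_n) x y w : ip B w (x + y) = ip B w x + ip B w y.
Proof. by rewrite /ip linearD /= mulmxDr mxE. Qed.

Lemma ipZl (R : realType) n (B : 'M[R]_n) a x w : ip B (a *: x) w = a * ip B x w.
Proof. by rewrite /ip -!scalemxAl mxE. Qed.

Lemma ipZr (R : realType) n (B : 'M[R]_n) a x w : ip B w (a *: x) = a * ip B w x.
Proof. by rewrite /ip linearZ /= -scalemxAr mxE. Qed.

Lemma ipNl (R : realType) n (B : 'M[R]_n) x w : ip B (- x) w = - ip B x w.
Proof. by rewrite -scaleN1r ipZl mulN1r. Qed.

Lemma ipNr (R : realType) n (B : 'M[R]_n) x w : ip B w (- x) = - ip B w x.
Proof. by rewrite -scaleN1r ipZr mulN1r. Qed.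

Lemma ipC (R : realType) n (B : 'M[R]_n) x y : posdef B -> ip B x y = ip B y x.
Proof.
move=> [BT _]; rewrite /ip -[RHS]trace_mx11 -mxtrace_tr trace_mx11.
by rewrite !trmx_mul trmxK BT mulmxA.
Qed.

Lemma ip_ge0 (R : realType) n (B : 'M[R]_n) x : posdef B -> 0 <= ip B x x.
Proof.
move=> [_ Bp]; have [->|x0] := eqVneq x 0; first by rewrite /ip !mul0mx mxE.
exact/ltW/Bp.
Qed.

Lemma sqr_normB (R : realType) n (B : 'M[R]_n) x : posdef B -> normB B x ^+ 2 = ip B x x.
Proof. by move=> hB; rewrite sqr_sqrtr// ip_ge0. Qed.

Lemma normB_ge0 (R : realType) n (B : 'M[R]_n) x : 0 <= normB B x.
Proof. exact: sqrtr_ge0. Qed.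

Lemma normB_gt0 (R : realType) n (B : 'M[R]_n) x : posdef B -> x != 0 -> 0 < normB B x.
Proof. by move=> [_ hB] /hB; rewrite sqrtr_gt0. Qed.

Lemma normBZ (R : realType) n (B : 'M[R]_n) a x : normB B (a *: x) = `|a| * normB B x.
Proof.
by rewrite /normB -/(ip _ _ _) ipZl ipZr mulrA -expr2 sqrtrM ?sqr_ge0// sqrtr_sqr.
Qed.

Lemma normBN (R : realType) n (B : 'M[R]_n) x : normB B (- x) = normB B x.
Proof. by rewrite -scaleN1r normBZ normrN1 mul1r. Qed.

Lemma normB0 (R : realType) n (B : 'M[R]_n) : normB B 0 = 0.
Proof. by rewrite /normB !mul0mx mxE sqrtr0. Qed.

Lemma ip_le_normB (R : realType) n (B : 'M[R]_n) x y :
  posdef B -> `|ip B x y| <= normB B x * normB B y.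
Proof.
move=> hB; have [->|y0] := eqVneq y 0.
  by rewrite normB0 mulr0 /ip linear0 mulmx0 mxE normr0.
have ny := normB_gt0 hB y0.
(* The vector tested next is [ip B y y] times the component of [x] orthogonal to [y], which keeps
   the expansion free of division. *)
rewrite -ler_sqr ?nnegrE ?mulr_ge0 ?normB_ge0// real_normK ?num_real// exprMn.
have := ip_ge0 (ip B y y *: x - ip B x y *: y) hB.
rewrite !(ipDl, ipDr, ipZl, ipZr, ipNl, ipNr) (ipC y x hB) !sqr_normB//.
have yy : 0 < ip B y y by rewrite -sqr_normB// exprn_gt0.
set X := ip B x x; set Y := ip B y y in yy *; set W := ip B x y.
rewrite (_ : _ + _ = Y * (X * Y - W ^+ 2)); last by ring.
by rewrite pmulr_rge0// subr_ge0.
Qed.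

Lemma normBD_le (R : realType) n (B : 'M[R]_n) x y :
  posdef B -> normB B (x + y) <= normB B x + normB B y.
Proof.
move=> hB; rewrite -ler_sqr ?nnegrE ?addr_ge0 ?normB_ge0// sqr_normB// sqrrD !sqr_normB//.
rewrite !(ipDl, ipDr) (ipC y x hB).
have := le_trans (ler_norm _) (ip_le_normB x y hB); lra.
Qed.

Lemma posdef_unitmx (R : realType) n (B : 'M[R]_n) : posdef B -> B \in unitmx.
Proof.
move=> [_ Bp]; rewrite -row_free_unit; apply/row_freeP.
have /mulmx1_unit _ := mul1mx (1%:M : 'M[R]_n).
exists (invmx B); apply: mulmxV; rewrite -row_free_unit -kermx_eq0.
apply/rowV0P => v /sub_kermxP vB; apply: contraTeq isT => /Bp.
by rewrite vB mul0mx mxE ltxx.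
Qed.

Lemma pairing_ip (R : realType) n (B : 'M[R]_n) g x :
  posdef B -> pairing g x = ip B (g *m invmx B) x.
Proof. by move=> hB; rewrite /ip mulmxKV// posdef_unitmx. Qed.

(** [g *m invmx B] is the Riesz representative of [g]; through it statements on the dual norm reduce
    to statements on [ip]. *)
Lemma normBd_normB (R : realType) n (B : 'M[R]_n) g :
  posdef B -> normBd B g = normB B (g *m invmx B).
Proof.
move=> hB; rewrite /normB mulmxKV ?posdef_unitmx// trmx_mul trmx_inv hB.1 mulmxA.
by rewrite /normBd.
Qed.

Lemma normBd_mulB (R : realType) n (B : 'M[R]_n) x :
  posdef B -> normBd B (x *m B) = normB B x.
Proof. by move=> hB; rewrite normBd_normB// mulmxK// posdef_unitmx. Qed.

Lemma normBd_ge0 (R : realType) n (B : 'M[R]_n) g : 0 <= normBd B g.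
Proof. exact: sqrtr_ge0. Qed.

Lemma normBdD_le (R : realType) n (B : 'M[R]_n) x y :
  posdef B -> normBd B (x + y) <= normBd B x + normBd B y.
Proof. by move=> hB; rewrite !normBd_normB// mulmxDl normBD_le. Qed.

Lemma normBdZ (R : realType) n (B : 'M[R]_n) a x :
  posdef B -> normBd B (a *: x) = `|a| * normBd B x.
Proof. by move=> hB; rewrite !normBd_normB// -scalemxAl normBZ. Qed.

Lemma normBdN (R : realType) n (B : 'M[R]_n) x : posdef B -> normBd B (- x) = normBd B x.
Proof. by move=> hB; rewrite -scaleN1r normBdZ// normrN1 mul1r. Qed.

Lemma normBd_gt0 (R : realType) n (B : 'M[R]_n) g : posdef B -> g != 0 -> 0 < normBd B g.
Proof.
move=> hB g0; rewrite normBd_normB//; apply: normB_gt0 => //.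
by apply: contra_neq g0 => /(congr1 (mulmx^~ B)); rewrite mulmxKV ?posdef_unitmx// mul0mx.
Qed.

Lemma pairing_le (R : realType) n (B : 'M[R]_n) g x :
  posdef B -> `|pairing g x| <= normBd B g * normB B x.
Proof. by move=> hB; rewrite (pairing_ip _ _ hB)// normBd_normB// ip_le_normB. Qed.

(** Test with the Riesz representative of [g]: the pairing is then the square of the dual norm, and
    one factor cancels. *)
Lemma normBd_le (R : realType) n (B : 'M[R]_n) g M : posdef B -> 0 <= M ->
  (forall v, pairing g v <= M * normB B v) -> normBd B g <= M.
Proof.
move=> hB M0 /(_ (g *m invmx B)); rewrite (pairing_ip _ _ hB)// -sqr_normB// -normBd_normB//.
have [-> //|] := eqVneq (normBd B g) 0 => g0.
by rewrite expr2 ler_pM2r// lt_def g0 normBd_ge0.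
Qed.

Lemma pairingDl (R : realType) n (g1 g2 x : 'rV[R]_n) :
  pairing (g1 + g2) x = pairing g1 x + pairing g2 x.
Proof. by rewrite /pairing mulmxDl mxE. Qed.

Lemma pairingZl (R : realType) n a (g x : 'rV[R]_n) : pairing (a *: g) x = a * pairing g x.
Proof. by rewrite /pairing -scalemxAl mxE. Qed.

Lemma pairingNl (R : realType) n (g x : 'rV[R]_n) : pairing (- g) x = - pairing g x.
Proof. by rewrite -scaleN1r pairingZl mulN1r. Qed.

Lemma pairingZr (R : realType) n a (g x : 'rV[R]_n) : pairing g (a *: x) = a * pairing g x.
Proof. by rewrite /pairing linearZ /= -scalemxAr mxE. Qed.

Lemma pairingNr (R : realType) n (g x : 'rV[R]_n) : pairing g (- x) = - pairing g x.
Proof. by rewrite -scaleN1r pairingZr mulN1r. Qed.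

Lemma pairing_suml (R : realType) n (I : Type) (r : seq I) P (F : I -> 'rV[R]_n) x :
  pairing (\sum_(i <- r | P i) F i) x = \sum_(i <- r | P i) pairing (F i) x.
Proof. by rewrite /pairing mulmx_suml summxE. Qed.

Lemma pairing_mulB (R : realType) n (B : 'M[R]_n) x y : pairing (x *m B) y = ip B x y.
Proof. by []. Qed.

(** * Banach's theorem on symmetric multilinear forms *)

Lemma continuous_sum_seq (T : topologicalType) (R : realType) (I : Type) (r : seq I)
  (F : I -> T -> R) :
  (forall i, continuous (F i)) -> continuous (fun x => \sum_(i <- r) F i x).
Proof.
move=> cF; elim: r => [|i r IH].
  by under eq_fun do rewrite big_nil; exact: cst_continuous.
by under eq_fun do rewrite big_cons; move=> x; apply: continuousD; [exact: cF|exact: IH].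
Qed.

Lemma continuous_ip (T : topologicalType) (R : realType) n (B : 'M[R]_n) (u v : T -> 'rV[R]_n) :
  (forall j, continuous (fun X => u X 0 j)) -> (forall j, continuous (fun X => v X 0 j)) ->
  continuous (fun X => ip B (u X) (v X)).
Proof.
move=> cu cv.
have cvt j : continuous (fun X => (v X)^T j 0).
  by under eq_fun do rewrite mxE; exact: cv.
have cuB j : continuous (fun X => (u X *m B) 0 j).
  under eq_fun do rewrite mxE.
  by apply: continuous_sum_seq => i X; apply: continuousM; [exact: cu|exact: cst_continuous].
under eq_fun do rewrite /ip mxE.
by apply: continuous_sum_seq => j X; apply: continuousM; [exact: cuB|exact: cvt].
Qed.

(** Linearity is asked of the head only; [symmetric_on] carries it to the other slots. Lists of any
    other length than [p] are unconstrained, so plain sequences can stand for p-tuples. *)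
Definition multilinear (R : realType) n p (A : seq 'rV[R]_n -> R) :=
  forall s a u v, (size s).+1 = p -> A (a *: u + v :: s) = a * A (u :: s) + A (v :: s).

Definition symmetric_on (R : realType) n p (A : seq 'rV[R]_n -> R) :=
  forall s t, size s = p -> perm_eq s t -> A s = A t.

Lemma multilinear0 (R : realType) n p (A : seq 'rV[R]_n -> R) s :
  multilinear p A -> (size s).+1 = p -> A (0 :: s) = 0.
Proof.
by move=> Al sp; have := Al s (-1) 0 0 sp; rewrite scaler0 addr0 mulN1r addNr.
Qed.

Lemma multilinearZ (R : realType) n p (A : seq 'rV[R]_n -> R) s a u :
  multilinear p A -> (size s).+1 = p -> A (a *: u :: s) = a * A (u :: s).
Proof.
by move=> Al sp; rewrite -{1}[a *: u]addr0 Al// (multilinear0 Al)// addr0.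
Qed.

Lemma multilinear_sum (R : realType) n p (A : seq 'rV[R]_n -> R) s (I : Type) (r : seq I) a u :
  multilinear p A -> (size s).+1 = p ->
  A (\sum_(i <- r) a i *: u i :: s) = \sum_(i <- r) a i * A (u i :: s).
Proof.
move=> Al sp; elim: r => [|i r IH]; first by rewrite !big_nil (multilinear0 Al).
by rewrite !big_cons Al// IH.
Qed.

(** Expanding the head in the standard basis leaves continuous coordinates times forms in which a
    constant basis vector has joined the tail [t]; hence the induction on [W] with [t] general. *)
Lemma continuous_multilinear (T : topologicalType) (R : realType) n p
    (A : seq 'rV[R]_n -> R) (W : seq (T -> 'rV[R]_n)) t :
  symmetric_on p A -> multilinear p A -> (size W + size t)%N = p ->
  (forall i j, continuous (fun X => nth (fun=> 0) W i X 0 j)) ->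
  continuous (fun X => A ([seq w X | w <- W] ++ t)).
Proof.
move=> As Al; elim: W t => [|w W IH] t szp cW; first exact: (@cst_continuous _ _ (A t)).
have eqA X : A ([seq w X | w <- w :: W] ++ t) =
    \sum_(j < n) w X 0 j * A ([seq w X | w <- W] ++ delta_mx 0 j :: t).
  rewrite /= [w X in LHS]row_sum_delta (multilinear_sum _ _ _ Al).
    apply: eq_bigr => j _; congr (_ * _); apply: As => /=.
      by rewrite size_cat size_map.
    by rewrite perm_sym perm_catC/= perm_cons perm_catC.
  by rewrite size_cat size_map.
under eq_fun do rewrite eqA.
apply: continuous_sum_seq => j X; apply: continuousM; first exact: (cW 0%N).
by apply: IH => [|i]; [rewrite /= addnS|exact: (cW i.+1)].
Qed.

Lemma unit_normalize (R : realType) n (B : 'M[R]_n) x : posdef B -> x != 0 ->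
  normB B ((normB B x)^-1 *: x) = 1.
Proof.
move=> hB x0; rewrite normBZ gtr0_norm ?invr_gt0 ?normB_gt0// mulVf//.
by rewrite gt_eqF// normB_gt0.
Qed.

Lemma coord_le_normB (R : realType) n (B : 'M[R]_n) (x : 'rV[R]_n) j : posdef B ->
  `|x 0 j| <= normBd B (delta_mx 0 j) * normB B x.
Proof.
move=> hB; have <- : pairing (delta_mx 0 j) x = x 0 j.
  by rewrite /pairing -rowE !mxE.
exact: pairing_le.
Qed.

(* Replacing two vectors of a tuple maximizing [|A|] by their normalized sum
   again gives a maximizing tuple, by polarization and the parallelogram law. *)
Lemma bilinear_max_merge (R : realType) n (B : 'M[R]_n) (b : 'rV[R]_n -> 'rV[R]_n -> R) mu x y :
  posdef B -> (forall u v, b u v = b v u) ->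
  (forall a u v w, b (a *: u + v) w = a * b u w + b v w) ->
  (forall u v, normB B u = 1 -> normB B v = 1 -> `|b u v| <= mu) ->
  normB B x = 1 -> normB B y = 1 -> `|b x y| = mu -> x + y != 0 ->
  let w := (normB B (x + y))^-1 *: (x + y) in `|b w w| = mu.
Proof.
move=> hB bC bl bmu x1 y1.
have b0 v : b 0 v = 0.
  by have := bl (-1) 0 0 v; rewrite scaler0 addr0 mulN1r addNr.
have bZ a u v : b (a *: u) v = a * b u v by rewrite -{1}[a *: u]addr0 bl b0 addr0.
have bD u v w : b (u + v) w = b u w + b v w by rewrite -{1}[u]scale1r bl mul1r.
have bN u v : b (- u) v = - b u v by rewrite -scaleN1r bZ mulN1r.
have bq u : `|b u u| <= mu * normB B u ^+ 2.
  have [->|u0] := eqVneq u 0; first by rewrite normB0 b0 expr0n mulr0 normr0.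
  have nu := normB_gt0 hB u0.
  have := bmu _ _ (unit_normalize hB u0) (unit_normalize hB u0).
  rewrite bZ bC bZ mulrA normrM gtr0_norm ?mulr_gt0 ?invr_gt0//.
  by rewrite -invfM -expr2 mulrC ler_pdivrMr// exprn_gt0.
move=> bxy xy0 w.
have nw : normB B w = 1 by exact: unit_normalize.
apply/eqP; rewrite eq_le bmu//=.
rewrite /w bZ bC bZ mulrA normrM -invfM -expr2 normfV (ger0_norm (sqr_ge0 _)).
rewrite mulrC ler_pdivlMr ?exprn_gt0 ?normB_gt0//.
(* Polarization: 4 b(x,y) = b(x+y,x+y) - b(x-y,x-y). The last term is at most mu |x-y|^2 = mu (4 -
   |x+y|^2), which leaves at least mu |x+y|^2 for the first. *)
have := bq (x - y); rewrite !sqr_normB//.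
move: (sqr_normB x hB) (sqr_normB y hB); rewrite x1 y1 !expr1n => /esym X1 /esym Y1.
rewrite !(ipDl, ipDr, ipNl, ipNr) X1 Y1 (ipC y x hB).
rewrite !(bD, bN, bC _ (x + y), bC _ (x - y)) !opprK.
rewrite (bC y x) -bxy; move: (b x x) (b x y) (b y y) (ip B x y) => a c d e.
have [c0|c0] := leP 0 c.
  rewrite (ger0_norm c0) => /ler_normlP[H _].
  by apply: le_trans (ler_norm _); lra.
rewrite (ltr0_norm c0) => /ler_normlP[_ H].
by rewrite -normrN; apply: le_trans (ler_norm _); nra.
Qed.

Lemma multilinear_nseqZ (R : realType) n p (A : seq 'rV[R]_n -> R) m a u t :
  symmetric_on p A -> multilinear p A -> (m + size t)%N = p ->
  A (nseq m (a *: u) ++ t) = a ^+ m * A (nseq m u ++ t).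
Proof.
move=> As Al; elim: m t => [|m IH] t szp; first by rewrite expr0 mul1r.
have swap v : A (u :: (nseq m v ++ t)) = A (nseq m v ++ u :: t).
  apply: As; first by rewrite /= size_cat size_nseq -szp addSn.
  by rewrite perm_sym perm_catC/= perm_cons perm_catC.
rewrite /= (multilinearZ _ _ Al) ?size_cat ?size_nseq -?szp//.
by rewrite !swap IH ?exprS ?mulrA//= addnS -szp.
Qed.

Definition unit_tuple (R : realType) n (B : 'M[R]_n) p (s : seq 'rV[R]_n) :=
  size s = p /\ forall v, v \in s -> normB B v = 1.

(** Two compactness arguments: maximize [|A|] over tuples of unit vectors, then the length of the
    sum over the compact set of maximizers. A tuple is stored as a single point of ['rV_(p * n)],
    where closed bounded sets are compact. *)
Lemma exists_maximal_tuple (R : realType) n (B : 'M[R]_n) p (A : seq 'rV[R]_n -> R) s0 :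
  posdef B -> symmetric_on p A -> multilinear p A -> unit_tuple B p s0 ->
  exists s, [/\ unit_tuple B p s,
    forall t, unit_tuple B p t -> `|A t| <= `|A s| &
    forall t, unit_tuple B p t -> `|A t| = `|A s| ->
      ip B (\sum_(v <- t) v) (\sum_(v <- t) v) <= ip B (\sum_(v <- s) v) (\sum_(v <- s) v)].
Proof.
move=> hB As Al us0.
pose rw (i : 'I_p) (X : 'rV[R]_(p * n)) : 'rV[R]_n := row i (vec_mx X).
pose rows X := [seq rw i X | i <- enum 'I_p].
have szr X : size (rows X) = p by rewrite size_map size_enum_ord.
have crw i j : continuous (fun X => rw i X 0 j).
  under eq_fun do rewrite !mxE.
  exact: coord_continuous.
pose S := [set X | forall i, normB B (rw i X) = 1].
have SE : S = \bigcap_i ((fun X => ip B (rw i X) (rw i X)) @^-1` [set 1]).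
  apply/seteqP; split=> X /=.
    by move=> XS i _ /=; rewrite -sqr_normB// XS expr1n.
  move=> XS i; have := XS i Logic.I; rewrite /= -sqr_normB// => /eqP.
  rewrite sqrf_eq1 => /orP[/eqP//|/eqP e].
  by have := normB_ge0 B (rw i X); rewrite e; lra.
have clS : closed S.
  rewrite SE; apply: closed_bigI => i _; apply: preimage_closed; last exact: closed_eq.
  by move=> X _; apply: continuous_ip => // j; exact: crw.
have cpS : compact S.
  (* Each coordinate functional is bounded on unit vectors by its dual norm, so this sum bounds all
     coordinates at once. *)
  pose b := \sum_(j < n) normBd B (delta_mx 0 j).
  have := @rV_compact R (p * n) (fun=> `[- b, b]%classic) (fun=> segment_compact (a := - b) (b := b)).
  move=> cpb; apply: (subclosed_compact clS cpb) => X XS k /=; rewrite in_itv/= -ler_norml.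
  case: (mxvec_indexP k) => i j.
  have -> : X ord0 (mxvec_index i j) = rw i X 0 j by rewrite !mxE.
  apply: le_trans (coord_le_normB _ _ hB) _; rewrite XS mulr1.
  by rewrite /b (bigD1 j)//= lerDl sumr_ge0// => ? _; exact: normBd_ge0.
have tupS X : S X -> unit_tuple B p (rows X).
  by move=> XS; split=> // v /mapP[i _ ->].
have Stup t : unit_tuple B p t -> exists2 X, S X & rows X = t.
  move=> [tp tu]; pose X := mxvec (\matrix_(i < p) nth 0 t i); exists X.
    by move=> i; rewrite /rw mxvecK rowK tu// mem_nth// tp.
  apply: (@eq_from_nth _ 0); first by rewrite szr tp.
  move=> i; rewrite szr => lt_ip.
  rewrite (nth_map (Ordinal lt_ip)) ?size_enum_ord// /rw mxvecK rowK.
  by rewrite nth_enum_ord.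
have [X0 X0S _] := Stup _ us0.
have cA : continuous (fun X => `|A (rows X)|).
  move=> X; apply: (@continuous_comp _ _ _ (fun X => A (rows X)) Num.norm); last exact: norm_continuous.
  move: X; have -> : (fun X => A (rows X)) =
      (fun X => A ([seq w X | w <- [seq rw i | i <- enum 'I_p]] ++ [::])).
    by apply/funext => X; rewrite cats0 -map_comp.
  apply: continuous_multilinear As Al _ _ => [|i j]; first by rewrite size_map size_enum_ord addn0.
  have [lt_ip|le_pi] := ltnP i p.
    by rewrite (nth_map (Ordinal lt_ip)) ?size_enum_ord//; exact: crw.
  rewrite nth_default; last by rewrite size_map size_enum_ord.
  exact: (@cst_continuous _ _ ((0 : 'rV[R]_n) 0 j)).
have [X1 /set_mem X1S X1m] := compact_EVT_max (ex_intro _ _ X0S) cpS (continuous_subspaceT cA).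
pose S2 := S `&` ((fun X => `|A (rows X)|) @^-1` [set `|A (rows X1)|]).
have cpS2 : compact S2.
  apply: subclosed_compact cpS _; last by move=> X [].
  apply: closedI => //; apply: preimage_closed; last exact: closed_eq.
  by move=> X _; exact: cA.
pose f2 X := ip B (\sum_(v <- rows X) v) (\sum_(v <- rows X) v).
have cf2 : continuous f2.
  have H j : continuous (fun X => (\sum_(v <- rows X) v) 0 j).
    under eq_fun do rewrite big_map summxE.
    by apply: continuous_sum_seq => i; exact: crw.
  exact: continuous_ip.
have [X2 /set_mem[X2S X2A] X2m] :=
  compact_EVT_max (ex_intro _ X1 (conj X1S erefl)) cpS2 (continuous_subspaceT cf2).
exists (rows X2); split; first exact: tupS.
- by move=> t /Stup[X XS <-]; rewrite X2A; apply: X1m; rewrite inE.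
- move=> t /Stup[X XS <-] XA; apply: X2m; rewrite inE; split => //=.
  by rewrite XA X2A.
Qed.

(** With w = (x+y)/|x+y|, replacing x, y by w, w keeps [|A|] maximal but lengthens x+y to 2w.
    Flipping both signs shows that the other vectors have nonnegative product with x+y, so the whole
    sum would grow unless |x+y| = 2, that is x = y. *)
Lemma maximal_tuple_constant (R : realType) n (B : 'M[R]_n) p (A : seq 'rV[R]_n -> R) x y r :
  posdef B -> symmetric_on p A -> multilinear p A ->
  let s := x :: y :: r in unit_tuple B p s ->
  (forall t, unit_tuple B p t -> `|A t| <= `|A s|) ->
  (forall t, unit_tuple B p t -> `|A t| = `|A s| ->
      ip B (\sum_(v <- t) v) (\sum_(v <- t) v) <= ip B (\sum_(v <- s) v) (\sum_(v <- s) v)) ->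
  x = y.
Proof.
move=> hB As Al s [sp su] Amax Smax.
have x1 : normB B x = 1 by apply: su; rewrite !inE eqxx.
have y1 : normB B y = 1 by apply: su; rewrite !inE eqxx orbT.
have ut u v : normB B u = 1 -> normB B v = 1 -> unit_tuple B p (u :: v :: r).
  move=> u1 v1; split; first exact: sp.
  move=> w; rewrite !inE => /or3P[/eqP->//|/eqP->//|wr]; apply: su.
  by rewrite !inE wr !orbT.
pose b u v := A (u :: v :: r).
have bC u v : b u v = b v u.
  by apply: As => //; rewrite (perm_catCA [:: u] [:: v] r).
have bl a u v w : b (a *: u + v) w = a * b u w + b v w by apply: Al.
have bN u v : b (- u) v = - b u v.
  by rewrite /b -scaleN1r (multilinearZ _ _ Al)// mulN1r.
pose g := \sum_(v <- r) v.
have hS u v : normB B u = 1 -> normB B v = 1 -> `|b u v| = `|b x y| ->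
    ip B (u + (v + g)) (u + (v + g)) <= ip B (x + (y + g)) (x + (y + g)).
  by move=> u1 v1 /(Smax _ (ut _ _ u1 v1)); rewrite !big_cons.
have Nx : normB B (- x) = 1 by rewrite normBN.
have Ny : normB B (- y) = 1 by rewrite normBN.
have flip1 := hS (- x) y Nx y1; rewrite bN normrN in flip1.
have flip2 := hS x (- y) x1 Ny; rewrite bC bN normrN bC in flip2.
have flip3 := hS (- x) (- y) Nx Ny; rewrite bN bC bN opprK bC in flip3.
have [X1 Y1] : ip B x x = 1 /\ ip B y y = 1.
  by rewrite -!sqr_normB// x1 y1 expr1n.
(* If y = -x, flipping one sign changes the sum g into g + 2y or g - 2y; one of the two is longer
   than g. *)
have xy0 : x + y != 0.
  apply/eqP => /eqP; rewrite addr_eq0 => /eqP xy.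
  move: (flip1 erefl) (flip2 erefl); rewrite xy opprK.
  rewrite !(ipDl, ipDr, ipNl, ipNr) Y1 (ipC y g hB); lra.
have merge := bilinear_max_merge hB bC bl (fun u v u1 v1 => Amax _ (ut u v u1 v1)) x1 y1 erefl xy0.
have w1 := unit_normalize hB xy0.
have := hS _ _ w1 w1 merge; have := flip3 erefl.
have N0 := normB_gt0 hB xy0; have N2 := normBD_le x y hB.
have := sqr_normB (x + y) hB.
rewrite x1 y1 in N2; move: N0 N2; set N := normB B (x + y) => N0 N2.
rewrite !(ipDl, ipDr, ipNl, ipNr, ipZl, ipZr) X1 Y1 (ipC y x hB) (ipC y g hB) (ipC x g hB).
move=> NE F3 HW.
have l1 : 2^-1 <= N^-1 by rewrite lef_pV2 ?posrE//; lra.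
have lN : N^-1 * N = 1 by rewrite mulVf// gt_eqF.
suff : ip B (x - y) (x - y) <= 0.
  move=> xy; apply/eqP; rewrite -subr_eq0; apply: contraTT xy => /(hB.2).
  by rewrite -ltNge.
rewrite !(ipDl, ipDr, ipNl, ipNr) X1 Y1 (ipC y x hB).
move: NE F3 HW; move: (ip B x y) (ip B g x) (ip B g y) (ip B g g) => e gx gy gg NE F3 HW.
have E1 : N^-1 * (N^-1 * (1 + e) + N^-1 * (e + 1)) = 1.
  by rewrite -mulrDr -[RHS](mulr1 1) -[in RHS]lN [RHS]mulrACA -[N * N]expr2 NE; ring.
rewrite !E1 in HW.
have g0 : 0 <= gx + gy by lra.
have : 0 <= (N^-1 - 2^-1) * (gx + gy) by rewrite mulr_ge0// subr_ge0.
lra.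
Qed.

(* Banach: among the tuples maximizing [|A|], one with the longest sum is constant. *)
Theorem symmetric_multilinear_norm (R : realType) n (B : 'M[R]_n) p (A : seq 'rV[R]_n -> R) M s :
  posdef B -> symmetric_on p A -> multilinear p A ->
  (forall u, normB B u <= 1 -> `|A (nseq p u)| <= M) ->
  unit_tuple B p s -> `|A s| <= M.
Proof.
move=> hB As Al AM us.
have [t [ut tA tS]] := exists_maximal_tuple hB As Al us.
apply: le_trans (tA _ us) _.
suff [u u1 ->] : exists2 u, normB B u <= 1 & t = nseq p u by exact: AM.
case: ut => tp tu; case: t => [|x t] in tp tu tA tS *.
  by exists 0; rewrite ?normB0 -?tp.
exists x; first by rewrite tu// inE eqxx.
(* Every further entry [y] is compared with the head after symmetry has moved it to the second
   place. *)
rewrite -tp /=; congr (_ :: _); apply/all_pred1P/allP => y yt /=.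
have pt : perm_eq (x :: t) (x :: y :: rem y t) by rewrite perm_cons perm_to_rem.
have eA := As _ _ tp pt.
have eS : \sum_(v <- x :: t) v = \sum_(v <- x :: y :: rem y t) v by exact: perm_big.
rewrite eA in tA tS; rewrite eS in tS.
apply/eqP/esym; apply: (maximal_tuple_constant hB As Al _ tA tS).
by split=> [|v]; rewrite -(perm_size pt, perm_mem pt)//; exact: tu.
Qed.

Lemma symmetric_multilinear_mixed (R : realType) n (B : 'M[R]_n) p (A : seq 'rV[R]_n -> R) M u v :
  posdef B -> symmetric_on p.+1 A -> multilinear p.+1 A ->
  (forall u, normB B u <= 1 -> `|A (nseq p.+1 u)| <= M) ->
  `|A (v :: nseq p u)| <= M * normB B u ^+ p * normB B v.
Proof.
move=> hB As Al AM.
have M0 : 0 <= M by apply: le_trans (AM 0 _); rewrite ?normB0.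
have scal (x : 'rV[R]_n) : x != 0 -> x = normB B x *: ((normB B x)^-1 *: x).
  by move=> x0; rewrite scalerA divff ?scale1r// gt_eqF// normB_gt0.
have [->|v0] := eqVneq v 0.
  by rewrite (multilinear0 Al) ?size_nseq// normr0 normB0 mulr0.
have step t : (forall w, w \in t -> normB B w = 1) -> size t = p ->
    `|A (v :: t)| <= M * normB B v.
  move=> t1 tp; rewrite (scal v v0) (multilinearZ _ _ Al) ?tp// normrM.
  rewrite -(scal v v0) ger0_norm ?normB_ge0// mulrC ler_wpM2r ?normB_ge0//.
  apply: (symmetric_multilinear_norm hB As Al AM); split=> [|w]; first by rewrite /= tp.
  by rewrite inE => /predU1P[->|/t1//]; exact: unit_normalize.
(* In degree one [u] does not occur and the bound has factor [normB B u ^+ 0 = 1] even for [u = 0];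
   this case is split off before [u] is normalized. *)
case: p => [|p] in As Al AM step *.
  by rewrite expr0 mulr1; exact: step.
have [->|u0] := eqVneq u 0.
  have -> : A (v :: nseq p.+1 0) = A (0 :: v :: nseq p 0).
    by apply: As; rewrite /= ?size_nseq// (perm_catCA [:: v] [:: 0]).
  by rewrite (multilinear0 Al) /= ?size_nseq// normr0 normB0 expr0n mulr0 mul0r.
rewrite [X in nseq _ X](scal u u0).
have rot w : A (v :: nseq p.+1 w) = A (nseq p.+1 w ++ [:: v]).
  by apply: As; rewrite /= ?size_nseq// -(perm_rcons v (nseq p.+1 w)) -cats1.
rewrite rot (multilinear_nseqZ _ _ As Al) /= ?size_nseq ?addn1// normrM normrX.
rewrite (ger0_norm (normB_ge0 _ _)) mulrAC [leRHS]mulrC ler_wpM2l ?exprn_ge0 ?normB_ge0//.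
have := step (nseq p.+1 ((normB B u)^-1 *: u)); rewrite rot; apply.
  by move=> w /nseqP[-> _]; exact: unit_normalize.
by rewrite size_nseq.
Qed.

(** * Higher derivatives as symmetric multilinear forms *)

Lemma is_derive_line (R : realType) n (g : 'rV[R]_n -> R) x d (t : R) :
  derivable g (x + t *: d) d ->
  is_derive t (1 : R) (fun u : R => g (x + u *: d)) ('D_d g (x + t *: d)).
Proof.
move=> gd.
have E : (fun h : R => h^-1 *: (((fun u : R => g (x + u *: d)) \o shift t) (h *: (1 : R)) - g (x + t *: d)))
   = (fun h : R => h^-1 *: ((g \o shift (x + t *: d)) (h *: d) - g (x + t *: d))).
  apply/funext => h /=; congr (_ *: (g _ - _)).
  by rewrite [_ *: 1]mulr1 scalerDl addrCA addrA.
apply: DeriveDef; first by rewrite /derivable E.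
by rewrite /derive E.
Qed.

Lemma differentiable_expansion (R : realType) (V : normedModType R) (k : V -> R) y (e : R) :
  differentiable k y -> 0 < e ->
  exists2 r : R, 0 < r & forall u, `|u| < r -> `|k (y + u) - k y - 'D_u k y| <= e * `|u|.
Proof.
move=> kd e0.
have /eqaddoP/(_ _ e0) := diff_locally kd.
move=> /nbhs_ballP[r /= r0 hr]; exists r => // u ur.
have := hr u; rewrite /= -ball_normE /= sub0r normrN => /(_ ur).
rewrite deriveE// => H; rewrite [y + u]addrC -addrA -opprD; exact: H.
Qed.

Lemma norm_sub_halves (R : realType) (a b c d q e : R) :
  `|a - c - (d + q)| <= e / 2 -> `|b - c - q| <= e / 2 -> `|a - b - d| <= e.
Proof.
by move=> /ler_normlP[H1 H1'] /ler_normlP[H2 H2']; apply/ler_normlP; split; lra.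
Qed.

(** Second derivatives are not assumed continuous. The mean value theorem is applied to s |-> g(y +
    h v + s w) - g(y + s w), and the resulting difference of ['D_w g] is expanded around [y], the
    one point where ['D_w g] must be differentiable. *)
Lemma mixed_difference (R : realType) n (U : set 'rV[R]_n) (g : 'rV[R]_n -> R) y v w (e : R) :
  open U -> U y -> (forall z, U z -> differentiable g z) ->
  differentiable ('D_w g) y -> 0 < e ->
  exists2 r : R, 0 < r & forall h, 0 < h < r ->
    `|g (y + h *: v + h *: w) - g (y + h *: v) - g (y + h *: w) + g y
       - h ^+ 2 * 'D_v ('D_w g) y| <= e * h ^+ 2.
Proof.
move=> oU Uy gd kd e0.
(* For 0 <= s <= h both h v + s w and s w have norm at most h C; the added 1 keeps C positive when v
   = w = 0. *)
pose C := `|v| + `|w| + 1.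
have C0 : 0 < C by rewrite /C ltr_wpDl// addr_ge0.
have [r1 r10 hr1] := differentiable_expansion kd (divr_gt0 e0 (mulr_gt0 (ltr0n R 2) C0)).
have /nbhs_ballP[r2 /= r20 hr2] : nbhs y U by exact: open_nbhs_nbhs.
have inU u : `|u| < r2 -> U (y + u).
  move=> ur; apply: hr2; rewrite -ball_normE /=.
  by rewrite opprD addNKr normrN.
exists (Num.min r1 r2 / C); first by rewrite divr_gt0// lt_min r10.
move=> h /andP[h0]; rewrite ltr_pdivlMr// lt_min => /andP[hC1 hC2].
have small s : 0 <= s <= h -> `|h *: v + s *: w| <= h * C /\ `|s *: w| <= h * C.
  move=> /andP[s0 sh].
  have sw : `|s *: w| <= h * `|w| by rewrite normrZ ger0_norm// ler_wpM2r.
  have hv : `|h *: v| <= h * `|v| by rewrite normrZ gtr0_norm.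
  rewrite /C !mulrDr; split.
    apply: le_trans (ler_normD _ _) _; rewrite mulr1.
    by apply: le_trans (lerD hv sw) _; rewrite lerDl ltW.
  by apply: le_trans sw _; rewrite mulr1 -addrA addrCA lerDl addr_ge0 ?mulr_ge0// ltW.
pose psi (s : R) := g (y + h *: v + s *: w) - g (y + s *: w).
pose dpsi s := 'D_w g (y + h *: v + s *: w) - 'D_w g (y + s *: w).
have dpsiP s : 0 <= s <= h -> is_derive s (1 : R) psi (dpsi s).
  move=> /small[s1 s2]; apply: is_deriveB; apply: is_derive_line; apply: diff_derivable; apply: gd.
    by rewrite -addrA; apply: inU; apply: le_lt_trans s1 _.
  by apply: inU; apply: le_lt_trans s2 _.
have [s | | s sh psiE] := @MVT R psi dpsi 0 h h0.
- by rewrite in_itv/= => /andP[s0 sh]; apply: dpsiP; rewrite !ltW.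
- apply: derivable_within_continuous => s; rewrite in_itv/= => s0h.
  by case: (dpsiP s s0h).
have s0h : 0 <= s <= h by move: sh; rewrite in_itv/= => /andP[s0 sh]; rewrite !ltW.
have -> : g (y + h *: v + h *: w) - g (y + h *: v) - g (y + h *: w) + g y = dpsi s * h.
  have := psiE; rewrite /psi scale0r !addr0 subr0 => <-; ring.
have [s1 s2] := small _ s0h.
have H1 := hr1 _ (le_lt_trans s1 hC1); have H2 := hr1 _ (le_lt_trans s2 hC1).
have eC : e / (2 * C) * (h * C) = e * h / 2 by field; rewrite gt_eqF.
have e2C : 0 <= e / (2 * C) by rewrite ltW// divr_gt0// mulr_gt0.
have {}H1 := le_trans H1 (ler_wpM2l e2C s1).
have {}H2 := le_trans H2 (ler_wpM2l e2C s2).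
rewrite eC in H1 H2.
have lin : 'D_(h *: v + s *: w) ('D_w g) y = h * 'D_v ('D_w g) y + 'D_(s *: w) ('D_w g) y.
  by rewrite !deriveE// linearD linearZ.
rewrite lin [y + (_ + _)]addrA in H1.
rewrite /dpsi.
rewrite (_ : _ - _ = h * ('D_w g (y + h *: v + s *: w) - 'D_w g (y + s *: w) - h * 'D_v ('D_w g) y)); last by ring.
rewrite normrM gtr0_norm// expr2 mulrCA ler_pM2l//.
exact: norm_sub_halves H1 H2.
Qed.

Lemma norm_sub_common (R : realType) (a b c d p q H e : R) :
  `|a - b - c + d - p| <= e / 2 * H -> `|a - c - b + d - q| <= e / 2 * H -> `|p - q| <= H * e.
Proof.
by move=> /ler_normlP[H1 H1'] /ler_normlP[H2 H2']; apply/ler_normlP; split; lra.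
Qed.

(** The second difference over the parallelogram spanned by h v and h w is symmetric in v and w, and
    approximates h^2 times either mixed derivative. *)
Lemma derive_swap (R : realType) n (U : set 'rV[R]_n) (g : 'rV[R]_n -> R) y v w :
  open U -> U y -> (forall z, U z -> differentiable g z) ->
  differentiable ('D_v g) y -> differentiable ('D_w g) y ->
  'D_v ('D_w g) y = 'D_w ('D_v g) y.
Proof.
move=> oU Uy gd vd wd; apply/eqP; rewrite -subr_eq0 -normr_le0.
apply/ler_addgt0Pr => e e0; rewrite add0r.
have [r1 r10 h1] := mixed_difference v oU Uy gd wd (divr_gt0 e0 (ltr0n R 2)).
have [r2 r20 h2] := mixed_difference w oU Uy gd vd (divr_gt0 e0 (ltr0n R 2)).
pose h := Num.min r1 r2 / 2.
have m0 : 0 < Num.min r1 r2 by rewrite lt_min r10.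
have h0 : 0 < h by rewrite divr_gt0.
have : h < Num.min r1 r2 by rewrite /h; lra.
rewrite lt_min => /andP[hr1 hr2].
have {}h1 := h1 h; have {}h2 := h2 h; rewrite h0 hr1 in h1; rewrite h0 hr2 in h2.
have {}h1 := h1 erefl; have {}h2 := h2 erefl.
rewrite (addrAC y (h *: w)) in h2.
rewrite -(ler_pM2l (exprn_gt0 2 h0)) -{1}(gtr0_norm (exprn_gt0 2 h0)) -normrM mulrBr.
exact: norm_sub_common h1 h2.
Qed.

(** The head of [s] is the outermost derivative, the last one taken. Listing directions makes D^k f
    at a point a function on sequences, as [symmetric_on] and [multilinear] require. *)
Definition Dl (R : realType) n (f : 'rV[R]_n -> R) (s : seq 'rV[R]_n) : 'rV[R]_n -> R :=
  foldr (fun v g y => derive g y v) f s.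

Lemma Dk_Dl (R : realType) n (f : 'rV[R]_n -> R) u k : Dk f u k = Dl f (nseq k u).
Proof. by elim: k => //= k; rewrite /Dk /= => ->. Qed.

Lemma diffn_Dl (R : realType) n p (U : set 'rV[R]_n) (f : 'rV[R]_n -> R) s y :
  diffn p U f -> (size s < p)%N -> U y -> differentiable (Dl f s) y.
Proof.
elim: p f s => // p IH f s [fd fD] sp Uy.
(* [diffn] peels off the innermost derivative, and that is the last entry of [s]. *)
elim/last_ind: s sp => [|s v _] sp; first exact: fd.
rewrite /Dl foldr_rcons; apply: IH (fD v) _ Uy.
by rewrite size_rcons in sp.
Qed.

Lemma eq_derive_open (R : realType) n (U : set 'rV[R]_n) (g1 g2 : 'rV[R]_n -> R) y v :
  open U -> U y -> (forall z, U z -> g1 z = g2 z) -> 'D_v g1 y = 'D_v g2 y.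
Proof.
move=> oU Uy g12; apply: near_eq_derive.
by apply: (filterS g12); exact: open_nbhs_nbhs.
Qed.

(** Adjacent exchanges from [derive_swap] generate all permutations. An exchange below outer
    derivatives needs equality on the whole open [U], not only at [y]. *)
Lemma Dl_perm (R : realType) n p (U : set 'rV[R]_n) (f : 'rV[R]_n -> R) s t :
  open U -> diffn p U f -> (size s <= p)%N -> perm_eq s t ->
  forall y, U y -> Dl f s y = Dl f t y.
Proof.
move=> oU fd.
have swap u v r z : (size r + 2 <= p)%N -> U z -> Dl f (u :: v :: r) z = Dl f (v :: u :: r) z.
  rewrite addn2 => rp Uz; apply: (derive_swap (U := U) (g := Dl f r)) => //.
  - by move=> x Ux; apply: diffn_Dl fd _ Ux; apply: leq_trans rp; rewrite ltnW.
  - by have := @diffn_Dl _ _ _ _ _ (u :: r) z fd; apply.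
  - by have := @diffn_Dl _ _ _ _ _ (v :: r) z fd; apply.
have move_front a l r z : (size l + size r < p)%N -> U z ->
    Dl f (l ++ a :: r) z = Dl f (a :: l ++ r) z.
  elim: l z => [//|b l IH] z lp Uz.
  apply: etrans (swap b a (l ++ r) z _ Uz); last by rewrite size_cat addn2.
  apply: (eq_derive_open _ oU Uz) => x Ux; apply: IH => //; exact: ltnW.
elim: s t => [|a s IH] t; first by move=> _ /perm_size/esym/size0nil ->.
move=> sp pst y Uy.
have at' : a \in t by rewrite -(perm_mem pst) inE eqxx.
case/splitPr: at' pst => t1 t2 pst.
have szt : size s = (size t1 + size t2)%N.
  by have /perm_size := pst; rewrite /= size_cat /= addnS => -[].
rewrite move_front -?szt//.
apply: (eq_derive_open _ oU Uy) => x Ux; apply: IH => //; first exact: ltnW.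
by rewrite -(perm_cons a) (perm_trans pst)// perm_catC/= perm_cons perm_catC.
Qed.

Lemma Dl_linear_head (R : realType) n p (U : set 'rV[R]_n) (f : 'rV[R]_n -> R) s a u v y :
  diffn p U f -> (size s < p)%N -> U y ->
  Dl f (a *: u + v :: s) y = a * Dl f (u :: s) y + Dl f (v :: s) y.
Proof.
move=> fd sp Uy /=; have sd := diffn_Dl fd sp Uy.
by rewrite !deriveE// linearD linearZ.
Qed.

Lemma Dl_symmetric_on (R : realType) n p q (U : set 'rV[R]_n) (f : 'rV[R]_n -> R) y :
  open U -> diffn p U f -> (q <= p)%N -> U y -> symmetric_on q (fun s => Dl f s y).
Proof. by move=> oU fd qp Uy s t sq st; apply: (Dl_perm oU fd); rewrite ?sq. Qed.

Lemma Dl_multilinear (R : realType) n p q (U : set 'rV[R]_n) (f : 'rV[R]_n -> R) y :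
  diffn p U f -> (q <= p)%N -> U y -> multilinear q (fun s => Dl f s y).
Proof. by move=> fd qp Uy s a u v sq; apply: (Dl_linear_head _ _ _ fd); rewrite ?sq. Qed.

(** * Taylor error of the gradient *)

Lemma is_derive_monomial (R : realType) (c t : R) k :
  is_derive t (1 : R) (fun u : R => c * (u ^+ k.+1 / (k.+1)`!%:R)) (c * (t ^+ k / k`!%:R)).
Proof.
have -> : (fun u : R => c * (u ^+ k.+1 / (k.+1)`!%:R)) =
   (c / (k.+1)`!%:R) \*: (fun u => u ^+ k.+1).
  by apply/funext => u /=; rewrite [RHS]mulrAC mulrA.
have dX : is_derive t (1 : R) (fun u : R => u ^+ k.+1) (k.+1%:R * t ^+ k).
  apply: DeriveDef; first exact: exprn_derivable.
  by rewrite exp_derive [in LHS]/GRing.scale/= mulr1.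
apply: is_derive_eq.
have k0 : (k.+1%:R : R) != 0 by rewrite pnatr_eq0.
have kf : (k`!%:R : R) != 0 by rewrite pnatr_eq0 -lt0n fact_gt0.
rewrite factS natrM -[LHS]/(_ * _).
by move: k0 kf; move: (k.+1%:R : R) (k`!%:R : R) => a b a0 b0; field; rewrite ?a0 ?b0.
Qed.

Lemma is_derive_sum_seq (R : realType) (I : Type) (r : seq I) (F : I -> R -> R) (dF : I -> R) t :
  (forall i, is_derive t (1 : R) (F i) (dF i)) ->
  is_derive t (1 : R) (fun u => \sum_(i <- r) F i u) (\sum_(i <- r) dF i).
Proof.
move=> HF; elim: r => [|i r IH].
  rewrite big_nil; under eq_fun do rewrite big_nil.
  exact: is_derive_cst.
rewrite big_cons; under eq_fun do rewrite big_cons.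
exact: is_deriveD.
Qed.

Lemma le_of_derive_le (R : realType) (psi dpsi chi dchi : R -> R) (t : R) : 0 <= t ->
  (forall u : R, 0 <= u <= t -> is_derive u (1 : R) psi (dpsi u)) ->
  (forall u : R, 0 <= u <= t -> is_derive u (1 : R) chi (dchi u)) ->
  (forall u : R, 0 <= u <= t -> dpsi u <= dchi u) ->
  psi t - psi 0 <= chi t - chi 0.
Proof.
move=> t0 psid chid le_d.
have dd (u : R) : 0 <= u <= t -> is_derive u (1 : R) (chi \- psi) (dchi u - dpsi u).
  by move=> ut; apply: is_deriveB; [exact: chid|exact: psid].
have [u | | u ut] := @MVT_segment R (chi \- psi) (fun u => dchi u - dpsi u) 0 t t0.
- by rewrite in_itv/= => /andP[u0 u1]; apply: dd; rewrite !ltW.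
- apply: derivable_within_continuous => u; rewrite in_itv/= => ut.
  by case: (dd u ut).
rewrite /= subr0 => E.
rewrite -subr_ge0 (_ : _ - _ = chi t - psi t - (chi 0 - psi 0)); last by ring.
by rewrite E mulr_ge0// subr_ge0 le_d//; move: ut; rewrite in_itv.
Qed.

(** The top derivative [phi m] is only Lipschitz at 0, so no derivative of order m+1 can be used.
    The induction integrates the bound for [phi 1] by comparing derivatives, once for each sign. *)
Lemma taylor_remainder (R : realType) (phi : nat -> R -> R) (C : R) m :
  (forall j (t : R), (j < m)%N -> 0 <= t <= 1 -> is_derive t (1 : R) (phi j) (phi j.+1 t)) ->
  (forall t : R, 0 <= t <= 1 -> `|phi m t - phi m 0| <= C * t) ->
  forall t : R, 0 <= t <= 1 ->
  `|phi 0%N t - \sum_(0 <= j < m.+1) phi j 0 * (t ^+ j / j`!%:R)| <= C * (t ^+ m.+1 / (m.+1)`!%:R).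
Proof.
elim: m phi => [|m IH] phi dphi phiC t t01.
  by rewrite big_nat1 expr0 fact0 divr1 mulr1 expr1 divr1; exact: phiC.
have {}IH := IH (fun j => phi j.+1) _ phiC.
have {}IH : forall u : R, 0 <= u <= 1 -> `|phi 1%N u -
    \sum_(0 <= j < m.+1) phi j.+1 0 * (u ^+ j / j`!%:R)| <= C * (u ^+ m.+1 / (m.+1)`!%:R).
  by apply: IH => j u jm; apply: dphi.
pose psi u := phi 0%N u - \sum_(0 <= j < m.+1) phi j.+1 0 * (u ^+ j.+1 / (j.+1)`!%:R).
have [t0 t1] := andP t01.
have sub (u : R) : 0 <= u <= t -> 0 <= u <= 1 by move=> /andP[-> /le_trans->].
have dpsi (u : R) : 0 <= u <= t -> is_derive u (1 : R) psi
    (phi 1%N u - \sum_(0 <= j < m.+1) phi j.+1 0 * (u ^+ j / j`!%:R)).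
  move=> /sub u1; apply: is_deriveB; first exact: dphi.
  by apply: is_derive_sum_seq => j; exact: is_derive_monomial.
have dchi (c : R) u := is_derive_monomial c u m.+1.
have psi0 : psi 0 = phi 0%N 0.
  by rewrite /psi big1 ?subr0// => j _; rewrite expr0n mul0r mulr0.
have z0 (c : R) : c * (0 ^+ m.+2 / (m.+2)`!%:R) = 0 by rewrite expr0n mul0r mulr0.
have -> : phi 0%N t - \sum_(0 <= j < m.+2) phi j 0 * (t ^+ j / j`!%:R) = psi t - psi 0.
  rewrite big_nat_recl// expr0 fact0 divr1 mulr1 psi0 /psi; ring.
apply/ler_normlP; split.
- have := @le_of_derive_le R (fun u => - C * (u ^+ m.+2 / (m.+2)`!%:R)) _ psi _ t t0
    (fun u _ => dchi (- C) u) dpsi.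
  rewrite z0 subr0 mulNr => H; rewrite lerNl; apply: H => u /sub/IH.
  by rewrite mulNr => /ler_normlP[]; rewrite lerNl.
- have := @le_of_derive_le R psi _ (fun u => C * (u ^+ m.+2 / (m.+2)`!%:R)) _ t t0
    dpsi (fun u _ => dchi C u).
  by rewrite z0 subr0 => H; apply: H => u /sub/IH/ler_normlP[].
Qed.

Lemma pairing_row (R : realType) n (F : 'rV[R]_n -> R) v :
  (forall a u w, F (a *: u + w) = a * F u + F w) ->
  pairing (\row_i F (delta_mx 0 i)) v = F v.
Proof.
move=> Fl; pose A (s : seq 'rV[R]_n) := F (head 0 s).
have Al : multilinear 1 A by move=> [|? ?] a u w // _; exact: Fl.
have := multilinear_sum (index_enum 'I_n) (v 0) (fun i : 'I_n => delta_mx 0 i) Al (s := [::]) erefl.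
rewrite /A/= -row_sum_delta => ->.
by rewrite /pairing mxE; apply: eq_bigr => i _; rewrite !mxE mulrC.
Qed.

Lemma Dmixed_Dl (R : realType) n (f : 'rV[R]_n -> R) u k v y :
  Dmixed f u k v y = Dl f (v :: nseq k u) y.
Proof. by rewrite /Dmixed Dk_Dl. Qed.

Lemma pairing_grad (R : realType) n (f : 'rV[R]_n -> R) y v :
  differentiable f y -> pairing (grad f y) v = 'D_v f y.
Proof.
move=> fd; rewrite /grad (pairing_row (F := fun v => 'D_v f y))// => a u w.
by rewrite !deriveE// linearD linearZ.
Qed.

Lemma pairing_taylor_grad (R : realType) n p (U : set 'rV[R]_n) (f : 'rV[R]_n -> R) x y v :
  diffn p U f -> U x ->
  pairing (taylor_grad p f x y) v =
    \sum_(0 <= j < p) Dl f (v :: nseq j (y - x)) x / j`!%:R.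
Proof.
move=> fd Ux; rewrite /taylor_grad big_add1/= pairing_suml [LHS]big_nat [RHS]big_nat.
apply: eq_bigr => j /= jp.
rewrite pairingZl (pairing_row (F := fun v => Dmixed f (y - x) j v x)).
  by rewrite Dmixed_Dl mulrC.
move=> a u w; rewrite !Dmixed_Dl (Dl_linear_head _ _ _ fd)//.
by rewrite size_nseq.
Qed.

(** For fixed v, apply the scalar Taylor bound to [phi j t], the derivative of order j+1 at x + t d
    in the directions d (j times) and v. The increment of the top one is a mixed value of a
    symmetric form, whence Banach's theorem. *)
Lemma taylor_grad_error (R : realType) n p (B : 'M[R]_n) (U S : set 'rV[R]_n)
    (f : 'rV[R]_n -> R) L x z :
  posdef B -> open U -> diffn p.+1 U f -> S `<=` U -> 0 <= L ->
  (forall t : R, 0 <= t <= 1 -> S (x + t *: (z - x))) ->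
  (forall y w : 'rV[R]_n, S y -> S w -> forall u : 'rV[R]_n, normB B u <= 1 ->
      `|Dk f u p.+1 y - Dk f u p.+1 w| <= L * normB B (y - w)) ->
  normBd B (grad f z - taylor_grad p.+1 f x z) <= L / (p.+1)`!%:R * normB B (z - x) ^+ p.+1.
Proof.
move=> hB oU fd SU L0 seg hL.
set d := z - x.
have Sx : S x by have := seg 0; rewrite scale0r addr0 lexx ler01; exact.
have Sz : S z by have := seg 1; rewrite scale1r subrKC lexx ler01; exact.
have Ux := SU _ Sx; have Uz := SU _ Sz.
have r0 := normB_ge0 B d.
have key v : `|pairing (grad f z - taylor_grad p.+1 f x z) v| <=
    L / (p.+1)`!%:R * normB B d ^+ p.+1 * normB B v.
  pose phi j t := Dl f (nseq j d ++ [:: v]) (x + t *: d).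
  have phi0 j : (j <= p)%N -> phi j 0 = Dl f (v :: nseq j d) x.
    move=> jp; rewrite /phi scale0r addr0; apply: (Dl_perm oU fd) => //.
      by rewrite size_cat size_nseq addn1.
    by rewrite perm_catC.
  have := @taylor_remainder R phi (L * normB B d ^+ p.+1 * normB B v) p _ _ 1.
  have -> : phi 0%N 1 = 'D_v f z by rewrite /phi /= scale1r subrKC.
  rewrite pairingDl pairingNl pairing_grad; last exact: (diffn_Dl (s := [::]) fd).
  rewrite (pairing_taylor_grad _ _ fd)//.
  have -> : \sum_(0 <= j < p.+1) phi j 0 * (1 ^+ j / j`!%:R) =
            \sum_(0 <= j < p.+1) Dl f (v :: nseq j d) x / j`!%:R.
    rewrite [LHS]big_nat [RHS]big_nat; apply: eq_bigr => j /= jp.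
    by rewrite phi0// expr1n mul1r.
  have -> : L * normB B d ^+ p.+1 * normB B v * (1 ^+ p.+1 / (p.+1)`!%:R) =
            L / (p.+1)`!%:R * normB B d ^+ p.+1 * normB B v.
    by rewrite expr1n mul1r mulrC !mulrA (mulrC _^-1).
  apply; last by rewrite ler01 lexx.
  - move=> j t jp t01; apply: is_derive_line; apply: diff_derivable.
    apply: (diffn_Dl fd); last exact/SU/seg.
    by rewrite size_cat size_nseq addn1.
  - move=> t t01; rewrite -/(phi p 0).
    pose A s := Dl f s (x + t *: d) - Dl f s x.
    have Uxt : U (x + t *: d) by exact/SU/seg.
    have As : symmetric_on p.+1 A.
      move=> s s' sp ss'; rewrite /A; congr (_ - _).
        by apply: (Dl_symmetric_on oU fd (leqnn _) Uxt).
      by apply: (Dl_symmetric_on oU fd (leqnn _) Ux).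
    have Al : multilinear p.+1 A.
      move=> s a u w sp; rewrite /A.
      rewrite (Dl_multilinear fd (leqnn _) Uxt a u w sp) (Dl_multilinear fd (leqnn _) Ux a u w sp).
      ring.
    have := symmetric_multilinear_mixed d v hB As Al (M := L * normB B (t *: d)) _.
    have -> : A (v :: nseq p d) = phi p t - phi p 0.
      rewrite phi0// /A; congr (_ - _); apply: (Dl_perm oU fd) => //=.
        by rewrite size_nseq.
      by rewrite perm_sym perm_catC.
    have -> : L * normB B (t *: d) * normB B d ^+ p * normB B v =
       L * normB B d ^+ p.+1 * normB B v * t.
      by rewrite normBZ ger0_norm ?(andP t01).1// exprS; ring.
    apply=> u u1; rewrite /A -!Dk_Dl.
    have := hL _ _ (seg _ t01) Sx _ u1.
    by rewrite addrAC subrr add0r.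
apply: normBd_le => //; last by move=> v; apply: le_trans (ler_norm _) (key v).
by rewrite mulr_ge0 ?divr_ge0 ?exprn_ge0.
Qed.

(** * First-order conditions *)

Definition conv_on (R : realType) n (S : set 'rV[R]_n) (hr : 'rV[R]_n -> R) :=
  forall x y t, S x -> S y -> 0 <= t <= 1 ->
    S (t *: x + (1 - t) *: y) /\ hr (t *: x + (1 - t) *: y) <= t * hr x + (1 - t) * hr y.

Lemma conv_on_segment (R : realType) n (S : set 'rV[R]_n) (hr : 'rV[R]_n -> R) x y t :
  conv_on S hr -> S x -> S y -> 0 <= t <= 1 ->
  S (x + t *: (y - x)) /\ hr (x + t *: (y - x)) <= hr x + t * (hr y - hr x).
Proof.
move=> cS Sx Sy t01; have := cS y x t Sy Sx t01.
have -> : t *: y + (1 - t) *: x = x + t *: (y - x).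
  by rewrite scalerBr scalerBl scale1r addrCA.
by have -> : t * hr y + (1 - t) * hr x = hr x + t * (hr y - hr x) by ring.
Qed.

Lemma is_derive_ge (R : realType) (q : R -> R) (d c : R) :
  is_derive (0 : R) (1 : R) q d -> (forall t, 0 <= t <= 1 -> - (t * c) <= q t - q 0) -> 0 <= d + c.
Proof.
move=> [qd dE] qc; rewrite leNgt; apply/negP => dc.
have e0 : 0 < - (d + c) / 2 by rewrite divr_gt0// oppr_gt0.
have qdiff : differentiable q 0 by exact/derivable1_diffP.
have [r r0 hr] := differentiable_expansion qdiff e0.
pose u := Num.min r 1 / 2.
have m0 : 0 < Num.min r 1 by rewrite lt_min r0 ltr01.
have u0 : 0 < u by rewrite divr_gt0.
have : u < Num.min r 1 by rewrite /u; lra.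
rewrite lt_min => /andP[ur u1].
have := hr u; rewrite gtr0_norm// add0r => /(_ ur).
have -> : 'D_u q 0 = u * d.
  by rewrite -dE !deriveE// -[u in LHS]mulr1 -[u * 1]/(u *: 1) linearZ.
have := qc u; rewrite (ltW u0) (ltW u1) => /(_ erefl).
move: (q u) (q 0) => a b H /ler_normlP[_ H2].
have : u * (d + c) >= u * ((d + c) / 2) by lra.
by rewrite ler_pM2l//; lra.
Qed.

(** Along the segment, [hr] grows at most linearly by convexity, so minimality bounds the decrease
    of the smooth part. Asking that [m] agree with [q] only for t in [0,1] admits norm powers that
    are replaced by polynomials for t >= 0. *)
Lemma first_order_min (R : realType) n (S : set 'rV[R]_n) (hr m : 'rV[R]_n -> R)
    (q : R -> R) (dm a : R) z y :
  conv_on S hr -> S z -> S y -> 0 <= a ->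
  (forall t, 0 <= t <= 1 -> m (z + t *: (y - z)) = q t) -> is_derive (0 : R) (1 : R) q dm ->
  (forall w, S w -> m z + a * hr z <= m w + a * hr w) ->
  0 <= dm + a * (hr y - hr z).
Proof.
move=> cS Sz Sy a0 mq qd zmin; apply: (is_derive_ge qd) => t t01.
have [Sw hw] := conv_on_segment cS Sz Sy t01.
have := zmin _ Sw; rewrite -mq// -mq ?lexx ?ler01// scale0r addr0.
have := ler_wpM2l a0 hw; move: (m _) (m _) (hr (_ + _)) => m1 m2 h1; lra.
Qed.

(** Instance of [first_order_min] with smooth part -f and convex part f: their sum is constant, so
    every point is a minimizer. *)
Lemma gradient_ineq (R : realType) n (U : set 'rV[R]_n) (f : 'rV[R]_n -> R) x y :
  conv_on U f -> U x -> U y -> differentiable f x -> f x + 'D_(y - x) f x <= f y.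
Proof.
move=> cU Ux Uy fd.
have L := is_derive_line (g := f) (x := x) (d := y - x) (t := 0).
rewrite scale0r addr0 in L.
have := @first_order_min R n U f (fun w => - f w) _ _ 1 x y cU Ux Uy ler01
  (fun t _ => erefl) (is_deriveN (L (diff_derivable fd))).
have H w : U w -> - f x + 1 * f x <= - f w + 1 * f w by rewrite !mul1r !addNr.
by move=> /(_ H); rewrite mul1r; lra.
Qed.

(** [x] minimizes f - <g, . - x> + hr, whose smooth part has gradient grad f - g at [x]. *)
Lemma subgradient_split (R : realType) n (S : set 'rV[R]_n) (f hr : 'rV[R]_n -> R) g x y :
  conv_on S hr -> S x -> S y -> differentiable f x ->
  (forall w, S w -> f x + hr x + pairing g (w - x) <= f w + hr w) ->
  hr x + pairing (g - grad f x) (y - x) <= hr y.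
Proof.
move=> cS Sx Sy fd gsub.
have L := is_derive_line (g := f) (x := x) (d := y - x) (t := 0).
rewrite scale0r addr0 in L; have {}L := L (diff_derivable fd).
pose m w := f w - pairing g (w - x).
pose q t := f (x + t *: (y - x)) - t * pairing g (y - x).
have mq (t : R) : 0 <= t <= 1 -> m (x + t *: (y - x)) = q t.
  by move=> _; rewrite /m /q addrAC subrr add0r pairingZr.
have qd : is_derive (0 : R) (1 : R) q ('D_(y - x) f x - pairing g (y - x)).
  apply: is_deriveB.
  have -> : ( *%R^~ (pairing g (y - x))) = pairing g (y - x) \*: (@id R).
    by apply/funext => t /=; rewrite mulrC.
  by apply: is_derive_eq; rewrite [LHS]mulr1.
have := first_order_min cS Sx Sy ler01 mq qd.
have H w : S w -> m x + 1 * hr x <= m w + 1 * hr w.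
  by move=> /gsub; rewrite /m subrr !mul1r {2}/pairing linear0 mulmx0 mxE; lra.
move=> /(_ H); rewrite pairingDl pairingNl pairing_grad//; lra.
Qed.

(** By symmetry all m slots contribute equally; the induction opens one slot by linearity and
    applies the product rule. *)
Lemma is_derive_nseq (R : realType) n p (A : seq 'rV[R]_n -> R) m w v t :
  symmetric_on p A -> multilinear p A -> (m + size t)%N = p ->
  is_derive (0 : R) (1 : R) (fun u : R => A (nseq m (w + u *: v) ++ t))
    (m%:R * A (v :: nseq m.-1 w ++ t)).
Proof.
move=> As Al; elim: m t => [|m IH] t szp.
  by rewrite mul0r; exact: (is_derive_cst (A t)).
have mv b c : A (b :: nseq m c ++ t) = A (nseq m c ++ b :: t).
  apply: As; first by rewrite /= size_cat size_nseq -szp addSn.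
  by rewrite perm_sym perm_catC/= perm_cons perm_catC.
have E : (fun u : R => A (nseq m.+1 (w + u *: v) ++ t)) =
   (fun u : R => u * A (nseq m (w + u *: v) ++ v :: t) + A (nseq m (w + u *: v) ++ w :: t)).
  apply/funext => u /=; rewrite {1}[w + _]addrC Al ?mv// size_cat size_nseq -szp addSn//.
rewrite E.
have D1 := IH (v :: t); have D2 := IH (w :: t); rewrite /= addnS -addSn in D1 D2.
have := is_deriveD (is_deriveM (is_derive_id (0 : R) (1 : R)) (D1 szp)) (D2 szp).
move=> D; apply: (is_derive_eq D).
rewrite scale0r add0r scale0r addr0 [_ *: 1]mulr1 /= mv.
case: m {IH E D1 D2 D} mv szp => [|m] mv szp; first by rewrite mul0r addr0 mul1r.
have -> : A (v :: nseq m.+1.-1 w ++ w :: t) = A (nseq m.+1 w ++ v :: t).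
  apply: As; first by rewrite /= size_cat size_nseq /= addnS -szp addSn.
  by apply/permP => b; rewrite /= !count_cat /= [RHS]addnCA [LHS]addnCA; congr (_ + _)%N; exact: addnCA.
by rewrite -[in RHS]natr1 mulrDl mul1r addrC.
Qed.

Lemma is_derive_taylor (R : realType) n p (U : set 'rV[R]_n) (f : 'rV[R]_n -> R) x y v :
  open U -> diffn p U f -> U x ->
  is_derive (0 : R) (1 : R) (fun u : R => taylor p f x (y + u *: v))
    (pairing (taylor_grad p f x y) v).
Proof.
move=> oU fd Ux.
have -> : (fun u : R => taylor p f x (y + u *: v)) =
    cst (f x) + (fun u : R => \sum_(j < p) (j.+1`!%:R)^-1 * Dl f (nseq j.+1 (y - x + u *: v) ++ [::]) x).
  apply/funext => u; rewrite /taylor big_add1/= big_mkord; congr (_ + _).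
  by apply: eq_bigr => j _; rewrite Dk_Dl cats0 addrAC.
rewrite (pairing_taylor_grad _ _ fd)// big_mkord -[X in is_derive _ _ _ X]add0r.
apply: is_deriveD; apply: is_derive_sum_seq => j.
have D := is_derive_nseq (y - x) v (Dl_symmetric_on oU fd (ltn_ord j) Ux)
  (Dl_multilinear fd (ltn_ord j) Ux) (m := j.+1) (t := [::]) (addn0 _).
have := is_deriveZ (j.+1`!%:R)^-1 D.
move=> H; apply: (is_derive_eq H); rewrite cats0 /= -[LHS]/(_ * _).
rewrite mulrA mulrC; congr (_ * _).
by rewrite factS natrM invfM mulrAC mulVf ?mul1r// pnatr_eq0.
Qed.

(** At d = 0 the function is |t|^(m+2) times a constant, and the monomial t^(m+2) serves as [q] for
    t >= 0. Otherwise the squared norm is a quadratic that is positive at 0, where the square root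
    is differentiable. *)
Lemma normB_pow_line (R : realType) n (B : 'M[R]_n) d v m : posdef B ->
  exists2 q : R -> R, forall t : R, 0 <= t -> normB B (d + t *: v) ^+ m.+2 = q t &
    is_derive (0 : R) (1 : R) q (m.+2%:R * normB B d ^+ m * ip B d v).
Proof.
move=> hB; have [->|d0] := eqVneq d 0.
  exists (fun t => normB B v ^+ m.+2 * (m.+2)`!%:R * (t ^+ m.+2 / (m.+2)`!%:R)).
    move=> t t0; rewrite add0r normBZ ger0_norm// exprMn mulrC -[RHS]mulrA; congr (_ * _).
    by rewrite mulrC divfK// pnatr_eq0 -lt0n fact_gt0.
  apply: (is_derive_eq (is_derive_monomial _ _ _)).
  by rewrite expr0n !mul0r mulr0 /ip !mul0mx mxE mulr0.
pose P t := ip B d d + t * (2 * ip B d v) + ip B v v * t ^+ 2.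
exists (fun t => Num.sqrt (P t) ^+ m.+2).
  move=> t _; congr (_ ^+ _); congr Num.sqrt; rewrite -/(ip _ _ _) /P.
  by rewrite !(ipDl, ipDr, ipZl, ipZr) (ipC v d hB); ring.
have dP : is_derive (0 : R) (1 : R) P (2 * ip B d v).
  have D1 := is_derive_monomial (2 * ip B d v) 0 0.
  have D2 := is_derive_monomial (2 * ip B v v) 0 1.
  have := is_deriveD (is_deriveD (is_derive_cst (ip B d d) (0 : R) (1 : R)) D1) D2.
  rewrite (_ : _ + _ + _ = P); last first.
    by apply/funext => t; rewrite /P; congr (_ + _ + _) => //=;
       rewrite ?fact0 ?(factS, fact0) ?divr1 ?expr1 ?muln1//; [rewrite mulrC|field].
  move=> H; apply: (is_derive_eq H).
  by rewrite add0r expr0 expr1 fact0 divr1 mulr1 mul0r mulr0 addr0.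
have P0 : P 0 = normB B d ^+ 2 by rewrite sqr_normB// /P mul0r expr0n mulr0 !addr0.
have N0 := normB_gt0 hB d0.
have P00 : 0 < P 0 by rewrite P0 exprn_gt0.
have := is_deriveX m.+2 (is_derive1_comp (is_derive1_sqrt P00) dP).
rewrite (_ : (_ \o P) ^+ m.+2 = (fun t => Num.sqrt (P t) ^+ m.+2)); last first.
  by apply/funext => t; rewrite exprfctE.
move=> H; apply: (is_derive_eq H); rewrite -[LHS]/(_ * _) /= P0 sqrtr_sqr gtr0_norm// exprS.
by field; rewrite gt_eqF.
Qed.

(* [z] is a global minimizer of the model, so only [hr] has to be convex. *)
Lemma tensor_step_optimality (R : realType) n p (B : 'M[R]_n) (U S : set 'rV[R]_n)
    (f hr : 'rV[R]_n -> R) L a xk zt z y :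
  posdef B -> open U -> diffn p.+1 U f -> S `<=` U -> conv_on S hr ->
  0 <= a -> S zt -> S z -> S y ->
  (let M w := a * taylor p.+1 f zt w + (a * p.+1%:R * L) / (p.+2)`!%:R * normB B (w - zt) ^+ p.+2
     + 2^-1 * normB B (w - xk) ^+ 2 in
   forall w, S w -> M z + a * hr z <= M w + a * hr w) ->
  0 <= a * pairing (taylor_grad p.+1 f zt z) (y - z)
     + (a * p.+1%:R * L) / (p.+1)`!%:R * normB B (z - zt) ^+ p * ip B (z - zt) (y - z)
     + ip B (z - xk) (y - z) + a * (hr y - hr z).
Proof.
move=> hB oU fd SU cS a0 Szt Sz Sy zmin; set v := y - z.
pose M w := a * taylor p.+1 f zt w + (a * p.+1%:R * L) / (p.+2)`!%:R * normB B (w - zt) ^+ p.+2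
     + 2^-1 * normB B (w - xk) ^+ 2.
have {}zmin : forall w, S w -> M z + a * hr z <= M w + a * hr w := zmin.
have [q1 q1E q1d] := normB_pow_line (z - zt) v p hB.
have [q2 q2E q2d] := normB_pow_line (z - xk) v 0 hB.
have Td := is_derive_taylor z v oU fd (SU _ Szt).
pose c := (a * p.+1%:R * L) / (p.+2)`!%:R.
pose q := a \*: (fun u : R => taylor p.+1 f zt (z + u *: v)) + c \*: q1 + 2^-1 \*: q2.
have qd := is_deriveD (is_deriveD (is_deriveZ a Td) (is_deriveZ c q1d)) (is_deriveZ 2^-1 q2d).
have := first_order_min (q := q) (a := a) cS Sz Sy a0 _ qd zmin.
have Mq : forall t : R, 0 <= t <= 1 -> M (z + t *: (y - z)) = q t.
  move=> t /andP[t0 _]; rewrite /M /q -/v.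
  by rewrite -[z + _ - zt]addrAC -[z + _ - xk]addrAC q1E// q2E.
move=> /(_ Mq); congr (0 <= _); congr (_ + _ + _ + _).
  rewrite -[_ *: _]/(_ * _) !mulrA; congr (_ * _ * _).
  rewrite /c factS natrM; field.
  by rewrite !pnatr_eq0 -lt0n fact_gt0/=.
by rewrite -[_ *: _]/(_ * _) expr0 mulr1 mulKf// pnatr_eq0.
Qed.

(** * The inner method *)

Lemma gradient_monotone (R : realType) n (U : set 'rV[R]_n) (f : 'rV[R]_n -> R) x y :
  conv_on U f -> U x -> U y -> differentiable f x -> differentiable f y ->
  0 <= pairing (grad f y - grad f x) (y - x).
Proof.
move=> cU Ux Uy fx fy.
have := gradient_ineq cU Ux Uy fx; have := gradient_ineq cU Uy Ux fy.
rewrite -!pairing_grad// -[x - y]opprB pairingNr pairingDl pairingNl; lra.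
Qed.

(* [g] is a subgradient at [z] of the proximal function [a F + |. - xk|^2 / 2], expressed
   through the subgradient of [hr] it contains. *)
Definition prox_subgrad (R : realType) n (B : 'M[R]_n) (S : set 'rV[R]_n)
    (f hr : 'rV[R]_n -> R) (a : R) (xk z g : 'rV[R]_n) :=
  forall y, S y ->
    0 <= pairing (a *: grad f z + (z - xk) *m B - g) (y - z) + a * (hr y - hr z).

(** Convertible to the successor branch of [inner_grad], but depending on two consecutive points
    instead of a sequence. *)
Definition tensor_grad (R : realType) n p (L : R) (B : 'M[R]_n) (f : 'rV[R]_n -> R) a zt z :=
  a *: grad f z - a *: taylor_grad p f zt z
  - ((a * p%:R * L) / p`!%:R * normB B (z - zt) ^+ p.-1) *: ((z - zt) *m B).

Lemma tensor_step_prox_subgrad (R : realType) n p (B : 'M[R]_n) (U S : set 'rV[R]_n)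
    (f hr : 'rV[R]_n -> R) L a xk zt z :
  posdef B -> open U -> diffn p.+1 U f -> S `<=` U -> conv_on S hr ->
  0 <= a -> S zt -> S z ->
  (let M w := a * taylor p.+1 f zt w + (a * p.+1%:R * L) / (p.+2)`!%:R * normB B (w - zt) ^+ p.+2
     + 2^-1 * normB B (w - xk) ^+ 2 in
   forall w, S w -> M z + a * hr z <= M w + a * hr w) ->
  prox_subgrad B S f hr a xk z (tensor_grad p.+1 L B f a zt z).
Proof.
move=> hB oU fd SU cS a0 Szt Sz zmin y Sy.
have := tensor_step_optimality hB oU fd SU cS a0 Szt Sz Sy zmin.
congr (0 <= _); congr (_ + _).
rewrite /tensor_grad !(pairingDl, pairingNl, pairingZl, pairing_mulB) /=.
by move: (pairing _ _) (pairing _ _) (ip _ _ _) (ip _ _ _) => *; ring.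
Qed.

(** The Taylor error contributes L/(p+1)! and the regularizer (p+1) L/(p+1)!, here for degree
    p+1. *)
Lemma tensor_grad_le (R : realType) n p (B : 'M[R]_n) (U S : set 'rV[R]_n)
    (f : 'rV[R]_n -> R) L a zt z :
  posdef B -> open U -> diffn p.+1 U f -> S `<=` U -> 0 <= L -> 0 <= a ->
  (forall t : R, 0 <= t <= 1 -> S (zt + t *: (z - zt))) ->
  (forall y w : 'rV[R]_n, S y -> S w -> forall u : 'rV[R]_n, normB B u <= 1 ->
      `|Dk f u p.+1 y - Dk f u p.+1 w| <= L * normB B (y - w)) ->
  normBd B (tensor_grad p.+1 L B f a zt z) <=
    a * (p.+2%:R * L / (p.+1)`!%:R) * normB B (z - zt) ^+ p.+1.
Proof.
move=> hB oU fd SU L0 a0 seg hL.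
rewrite /tensor_grad -scalerBr.
have err := taylor_grad_error hB oU fd SU L0 seg hL.
apply: le_trans (normBdD_le _ _ hB) _; rewrite normBdN// !normBdZ// normBd_mulB//.
have r0 := normB_ge0 B (z - zt).
rewrite (ger0_norm a0) ger0_norm ?mulr_ge0 ?exprn_ge0 ?divr_ge0 ?mulr_ge0//=.
apply: le_trans (lerD (ler_wpM2l a0 err) (lexx _)) _.
rewrite le_eqVlt; apply/orP; left; apply/eqP.
have -> : (p.+2%:R : R) = p.+1%:R + 1 by rewrite -natr1.
rewrite exprS; ring.
Qed.

(** Test each of the two conditions at the other point and add: [hr] and the monotone part of f drop
    out, leaving r^2 <= <new gradient, d> - <old gradient, d>. The regularizer outweighs the Taylor
    error, so the new gradient has nonpositive product with d. *)
Lemma tensor_step_length (R : realType) n p (B : 'M[R]_n) (U S : set 'rV[R]_n)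
    (f hr : 'rV[R]_n -> R) L a xk zt z gt :
  posdef B -> open U -> diffn p.+1 U f -> S `<=` U -> conv_on U f -> 0 <= L -> 0 <= a ->
  (forall t : R, 0 <= t <= 1 -> S (zt + t *: (z - zt))) ->
  (forall y w : 'rV[R]_n, S y -> S w -> forall u : 'rV[R]_n, normB B u <= 1 ->
      `|Dk f u p.+1 y - Dk f u p.+1 w| <= L * normB B (y - w)) ->
  prox_subgrad B S f hr a xk zt gt ->
  prox_subgrad B S f hr a xk z (tensor_grad p.+1 L B f a zt z) ->
  normB B (z - zt) <= normBd B gt.
Proof.
move=> hB oU fd SU cU L0 a0 seg hL sgt sgz.
have Szt : S zt by have := seg 0; rewrite scale0r addr0 lexx ler01; exact.
have Sz : S z by have := seg 1; rewrite scale1r subrKC lexx ler01; exact.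
set d := z - zt.
have err := taylor_grad_error hB oU fd SU L0 seg hL.
have mono : 0 <= pairing (grad f z - grad f zt) d.
  by apply: gradient_monotone cU (SU _ Szt) (SU _ Sz) _ _;
    apply: (diffn_Dl (s := [::]) fd) => //; exact: SU.
have e1 := le_trans (ler_norm _) (pairing_le (grad f z - taylor_grad p.+1 f zt z) d hB).
have r0 : 0 <= normB B d := normB_ge0 B d.
have {err}e1 := le_trans e1 (ler_wpM2r r0 err).
have := sgz _ Szt; have := sgt _ Sz.
rewrite -[zt - z]opprB -/d pairingNr /tensor_grad.
have dd : pairing ((z - xk) *m B) d = pairing ((zt - xk) *m B) d + normB B d ^+ 2.
  by rewrite sqr_normB// !pairing_mulB /d !(ipDl, ipNl); ring.
have gN := ler_normlW (pairing_le (- gt) d hB); rewrite normBdN// pairingNl in gN.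
move: mono e1; rewrite !(pairingDl, pairingNl, pairingZl) dd.
rewrite (_ : pairing (d *m B) d = normB B d ^+ 2); last by rewrite sqr_normB.
rewrite /= -/d; set r := normB B d in r0 gN *.
set w := L / (p.+1)`!%:R * r ^+ p.+1 * r.
have w0 : 0 <= w by rewrite !mulr_ge0 ?invr_ge0 ?exprn_ge0.
have -> : a * p.+1%:R * L / (p.+1)`!%:R * r ^+ p * r ^+ 2 = a * w * p.+1%:R.
  by rewrite /w (exprS r p); ring.
have pw : a * w <= a * w * p.+1%:R by apply: ler_peMr; [exact: mulr_ge0|rewrite ler1n].
have [r00|rn0] := eqVneq r 0; first by rewrite r00 normBd_ge0.
move=> mono e1 H1 H2; suff : r * r <= normBd B gt * r by rewrite ler_pM2r// lt_def rn0.
have e2 := ler_wpM2l a0 e1; have m2 := mulr_ge0 a0 mono.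
move: gN e2 m2 H1 H2 pw; move: (normBd B gt * r) (a * w) (a * w * _).
move: (pairing (grad f z) d) (pairing (taylor_grad _ _ _ _) d) (pairing (grad f zt) d)
  (pairing (_ *m B) d) (pairing gt d) (hr z) (hr zt) => u1 u2 u3 u4 u5 h1 h2 G w2 w1.
by rewrite expr2; lra.
Qed.

(** * Real sequences *)

(** The condition on [a], [G], [c] says exactly that the claimed bound reproduces itself under g |->
    a c g^(p+1); at t = 0 it equals a G. *)
Lemma superlinear_decay (R : realType) (a G c : R) p (g : nat -> R) :
  0 <= a -> 0 <= c -> (forall t, 0 <= g t) -> g 0%N = a * G ->
  (forall t, g t.+1 <= a * c * g t ^+ p.+1) ->
  a ^+ p.+1 * (2 * G) ^+ p * c = 1 ->
  forall t, g t <= 2 * a * G * 2^-1 ^+ (p.+1 ^ t).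
Proof.
move=> a0 c0 g0 gE gS ac; elim=> [|t IH]; first by rewrite gE expn0 expr1; lra.
apply: le_trans (gS t) _.
have {}IH : g t ^+ p.+1 <= (2 * a * G * 2^-1 ^+ (p.+1 ^ t)) ^+ p.+1.
  by rewrite lerXn2r ?nnegrE ?(le_trans (g0 t) IH).
apply: le_trans (ler_wpM2l (mulr_ge0 a0 c0) IH) _.
rewrite exprMn -exprM -expnSr mulrA ler_wpM2r ?exprn_ge0 ?invr_ge0// le_eqVlt.
apply/orP; left; apply/eqP.
have -> : 2 * a * G = a * (2 * G) by ring.
transitivity (a * (2 * G) * (a ^+ p.+1 * (2 * G) ^+ p * c)); last by rewrite ac mulr1.
by rewrite exprMn [(2 * G) ^+ p.+1]exprS; ring.
Qed.

(** Step T-1 still exceeds delta, so (p+2)^(T-1) <= log2 X. The hypothesis 2 < X makes the iterated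
    logarithm positive, which settles T = 0. *)
Lemma superlinear_count (R : realType) (a G delta X : R) p (g : nat -> R) (T : nat) :
  (forall t, g t <= 2 * a * G * 2^-1 ^+ (p.+2 ^ t)) ->
  0 < delta -> 2 < X -> 2 * a * G / delta <= X ->
  (forall t, (t < T)%N -> delta < g t) ->
  T%:R <= 1 + (log2 p.+2%:R)^-1 * log2 (log2 X).
Proof.
move=> gT d0 X2 GX dT.
have l2 : 0 < ln 2 :> R by rewrite ln_gt0// ltr1n.
have lp : 0 < ln p.+2%:R :> R by rewrite ln_gt0// ltr1n.
have X0 : 0 < X by apply: lt_trans X2.
have lX : 1 < log2 X by rewrite /log2 ltr_pdivlMr// mul1r ltr_ln ?posrE.
have -> : (log2 p.+2%:R)^-1 * log2 (log2 X) = ln (log2 X) / ln p.+2%:R.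
  rewrite {1 2}/log2; field; rewrite !gt_eqF//.
case: T dT => [|T] dT.
  by rewrite addr_ge0// divr_ge0 ?ln_ge0 ?ler1n// ltW.
rewrite -natr1 addrC lerD2l ler_pdivlMr//.
rewrite mulr_natl -lnXn// ler_ln ?posrE ?exprn_gt0 ?(lt_trans ltr01) ?ltr1n//.
rewrite /log2 ler_pdivlMr// -natrX mulr_natl -lnXn// ler_ln ?posrE ?exprn_gt0//.
apply: le_trans GX; rewrite ler_pdivlMr//.
have := ltW (lt_le_trans (dT _ (leqnn _)) (gT T)).
by rewrite exprVn ler_pdivlMr ?exprn_gt0// mulrC.
Qed.

Lemma sum_powR_le (R : realType) (s : R) k : 1 < s ->
  \sum_(1 <= i < k.+1) powR i%:R (- s) <= s / (s - 1).
Proof.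
move=> s1; have s10 : 0 < s - 1 by rewrite subr_gt0.
case: k => [|k].
  by rewrite big_geq// divr_ge0 ?ltW// (lt_trans ltr01).
(* The strengthened bound is 1 plus the integral of x^(-s) from 1 to k+1. *)
suff H : \sum_(1 <= i < k.+2) powR i%:R (- s) <= s / (s - 1) - powR k.+1%:R (1 - s) / (s - 1).
  by apply: le_trans H _; rewrite gerBl divr_ge0 ?powR_ge0// ltW.
elim: k => [|k IH].
  by rewrite big_nat1 !powR1 -mulrBl divff ?gt_eqF.
rewrite big_nat_recr//=; apply: le_trans (lerD IH (lexx _)) _.
suff : powR k.+2%:R (- s) <= powR k.+1%:R (1 - s) / (s - 1) - powR k.+2%:R (1 - s) / (s - 1) by lra.
set u : R := k.+2%:R.
have u0 : 0 < u by rewrite ltr0n.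
have u1 : (k.+1%:R : R) = u * (1 - u^-1) by rewrite mulrBr mulr1 divff ?gt_eqF// /u -[k.+2]addn1 natrD addrK.
have v0 : 0 < 1 - u^-1 by rewrite subr_gt0 invf_lt1// ltr1n.
have us : powR u (- s) = powR u (1 - s) / u.
  have e : - s = (1 - s) + (- 1) by ring.
  rewrite [in LHS]e [LHS]powRD; first by rewrite powR_inv1 ?ltW.
  by apply/implyP => _; rewrite gt_eqF.
have uu := powR_gt0 (1 - s) u0.
rewrite u1 us powRM; [|exact: ltW|exact: ltW].
(* Bernoulli's inequality for a negative exponent, from exp y >= 1 + y and ln(1 - 1/u) <= -1/u. *)
have key : 1 + (s - 1) / u <= powR (1 - u^-1) (1 - s).
  rewrite /powR gt_eqF//; apply: le_trans (expR_ge1Dx _); rewrite lerD2l.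
  rewrite -[1 - s]opprB mulNr -mulrN ler_wpM2l ?(ltW s10)// lerNr.
  by apply: le_ln1Dx; rewrite ltrN2 invf_lt1// ltr1n.
rewrite -mulrBl ler_pdivlMr//.
have := ler_wpM2l (ltW uu) key.
by move: (u^-1) (powR u _) (powR (1 - u^-1) _) => D A C; lra.
Qed.

(** The induction hypothesis also bounds rho k by rho 0 plus the past errors, and this controls the
    cross term 2 delta rho of the next square. *)
Lemma energy_sum (R : realType) (rho delta e : nat -> R) k :
  (forall i, 0 <= rho i) -> (forall i, 0 <= delta i) -> (forall i, 0 <= e i.+1) ->
  (forall i, e i.+1 + rho i.+1 ^+ 2 <= (rho i + delta i.+1) ^+ 2) ->
  \sum_(1 <= i < k.+1) e i + rho k ^+ 2 <= (rho 0%N + \sum_(1 <= i < k.+1) delta i) ^+ 2.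
Proof.
move=> r0 d0 e0 step; elim: k => [|k IH]; first by rewrite !big_geq// add0r addr0.
rewrite !(big_nat_recr k.+1)//= -addrA.
set E := \sum_(1 <= i < k.+1) e i in IH *; set S := \sum_(1 <= i < k.+1) delta i in IH *.
have E0 : 0 <= E by rewrite /E big_add1; apply: sumr_ge0.
have S0 : 0 <= S by apply: sumr_ge0.
have rk : rho k <= rho 0%N + S.
  rewrite -(@ler_pXn2r _ 2)// ?nnegrE ?addr_ge0//; lra.
have := step k; have := ler_wpM2r (d0 k.+1) rk.
move: IH; move: (rho k) (rho k.+1 ^+ 2) (rho 0%N) (delta k.+1) (e k.+1) => r r' r1 d e1.
rewrite !sqrrD; lra.
Qed.

(** Bound ln by its tangent at the mean; the linear terms cancel in the sum. *)
Lemma sum_ln_le (R : realType) (x : nat -> R) k : (0 < k)%N ->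
  (forall i, 0 < x i) ->
  \sum_(1 <= i < k.+1) ln (x i) <= k%:R * ln ((\sum_(1 <= i < k.+1) x i) / k%:R).
Proof.
move=> k0 x0; set A := \sum_(1 <= i < k.+1) x i.
have kR : 0 < k%:R :> R by rewrite ltr0n.
have A0 : 0 < A.
  by rewrite /A big_nat_recr//= ltr_wpDl// sumr_ge0// => i _; exact: ltW.
have m0 : 0 < A / k%:R by rewrite divr_gt0.
have H i : ln (x i) <= ln (A / k%:R) + (x i / (A / k%:R) - 1).
  have := @le_ln1Dx _ (x i / (A / k%:R) - 1); rewrite subrKC.
  rewrite ln_div ?posrE//.
  have : -1 < x i / (A / k%:R) - 1 by rewrite ltrBrDr addNr divr_gt0.
  by move=> /[swap] /[apply]; lra.
apply: le_trans (ler_sum_nat (fun i _ => H i)) _.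
rewrite big_split/= sumr_const_nat subn1/= mulr_natl gerDl.
rewrite sumrB -mulr_suml -/A sumr_const_nat subn1/=.
by rewrite invfM invrK mulrA divff ?gt_eqF// mul1r subrr.
Qed.

(** In logarithms everything is linear. Substituting [S1] and [S3] in [S4] puts p times the sum of
    ln a on both sides; one copy remains, so no (p+1)-th root is left in the bound. *)
Lemma step_size_sum (R : realType) (p k : nat) (Cp Rc : R) (a G : nat -> R) :
  (0 < p)%N -> (0 < k)%N -> 0 < Cp -> 0 < Rc ->
  (forall i, 0 < a i.+1) -> (forall i, 0 < G i) ->
  (forall i, a i.+1 ^+ p.+1 * (2 * G i) ^+ p = Cp) ->
  \sum_(1 <= i < k.+1) (a i * G i) ^+ 2 <= Rc ^+ 2 ->
  ln (G 0%N) - ln (G k) <= k%:R ->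
  powR k%:R ((p.+1%:R + 1) / 2) * Cp / (2 * expR 1 * Rc) ^+ p <= \sum_(1 <= i < k.+1) a i.
Proof.
move=> p0 k0 Cp0 R0 a0 G0 aG E lG.
have kR : 0 < k%:R :> R by rewrite ltr0n.
have pR : 0 < p%:R :> R by rewrite ltr0n.
have A0 : 0 < \sum_(1 <= i < k.+1) a i.
  case: k k0 {E lG kR} => // k _.
  by rewrite big_add1/= big_nat_recr//= ltr_wpDl// sumr_ge0// => i _; exact: ltW.
pose l i := ln (a i.+1); pose g i := ln (G i).
have lg i : p.+1%:R * l i = ln Cp - p%:R * (ln 2 + g i).
  rewrite -(aG i) lnM ?posrE ?exprn_gt0 ?mulr_gt0// !lnXn ?mulr_gt0// lnM ?posrE//.
  by rewrite /l /g !mulr_natl addrK.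
have S1 : \sum_(0 <= i < k) (2 * (l i + g i.+1)) <= k%:R * ln (Rc ^+ 2 / k%:R).
  have := @sum_ln_le R (fun i => (a i.-1.+1 * G i) ^+ 2) k k0 (fun i => exprn_gt0 2 (mulr_gt0 (a0 _) (G0 _))).
  rewrite !big_add1/= => H.
  have -> : \sum_(0 <= i < k) (2 * (l i + g i.+1)) = \sum_(0 <= i < k) ln ((a i.+1 * G i.+1) ^+ 2).
    by apply: eq_bigr => i _; rewrite lnXn ?mulr_gt0// lnM ?posrE// mulr_natl.
  apply: le_trans H _; rewrite ler_pM2l// ler_ln ?posrE.
  - by rewrite ler_pM2r ?invr_gt0//; rewrite big_add1/= in E.
  - rewrite divr_gt0//; case: k k0 {E lG kR A0} => // k _.
    by rewrite big_nat_recr//= ltr_wpDl ?exprn_gt0 ?mulr_gt0// sumr_ge0// => i _; rewrite exprn_ge0// ltW// mulr_gt0.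
  - by rewrite divr_gt0// exprn_gt0.
have S2 : \sum_(0 <= i < k) l i <= k%:R * ln ((\sum_(1 <= i < k.+1) a i) / k%:R).
  have := @sum_ln_le R (fun i => a i.-1.+1) k k0 (fun i => a0 _).
  by rewrite !big_add1.
(* [aG] involves G i but [S1] involves G (i+1); the boundary term is at most k and becomes the
   factor e per power. *)
have S3 : \sum_(0 <= i < k) g i = \sum_(0 <= i < k) g i.+1 + (g 0%N - g k).
  by have := telescope_sumr g (leq0n k); rewrite sumrB; lra.
have S4 : p.+1%:R * \sum_(0 <= i < k) l i =
    k%:R * (ln Cp - p%:R * ln 2) - p%:R * \sum_(0 <= i < k) g i.
  rewrite !mulr_sumr (eq_bigr _ (fun i _ => lg i)) sumrB sumr_const_nat subn0.
  under [X in _ - X]eq_bigr do rewrite mulrDr.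
  rewrite big_split/= sumr_const_nat subn0 -mulr_sumr -[_ *+ k]mulr_natl -[(_ * _) *+ k]mulr_natl.
  ring.
have lkR : ln (Rc ^+ 2 / k%:R) = 2 * ln Rc - ln k%:R.
  by rewrite ln_div ?posrE ?exprn_gt0// lnXn// mulr_natl.
have lAk : ln ((\sum_(1 <= i < k.+1) a i) / k%:R) = ln (\sum_(1 <= i < k.+1) a i) - ln k%:R.
  by rewrite ln_div ?posrE.
rewrite lkR in S1; rewrite lAk in S2.
rewrite -mulr_sumr big_split/= in S1.
have e0 : 0 < 2 * expR 1 * Rc by rewrite !mulr_gt0// expR_gt0.
rewrite -ler_ln ?posrE//; last first.
  by rewrite divr_gt0 ?exprn_gt0// mulr_gt0// powR_gt0.
rewrite ln_div ?posrE ?exprn_gt0 ?mulr_gt0 ?powR_gt0// lnM ?posrE ?powR_gt0// ln_powR.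
rewrite lnXn// -[_ *+ p]mulr_natl !lnM ?posrE ?expR_gt0 ?mulr_gt0 ?expR_gt0// expRK.
have pS : (p.+1%:R : R) = p%:R + 1 by rewrite -natr1.
rewrite -(ler_pM2l kR); apply: le_trans (le_trans _ (lerD S2 (lexx (k%:R * ln k%:R)))) _; last by lra.
rewrite pS in S4 *.
move: S1 S2 S3 S4 lG; rewrite -/(g 0%N) -/(g k).
move: (\sum_(0 <= i < k) l i) (\sum_(0 <= i < k) g i) (\sum_(0 <= i < k) g i.+1) => SL SG SG1.
move: (ln Cp) (ln 2) (ln Rc) (ln k%:R) (g 0%N) (g k) => lC l2 lR lk g0 gk S1 _ S3 S4 lG.
have := ler_wpM2l (ltW pR) S1; have := ler_wpM2l (ltW pR) lG.
move: S3 S4; move: (p%:R : R) (k%:R : R) => P K -> S4 H1 H2.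
lra.
Qed.

(** * The outer method *)

(** The rule for F1 says a F1 + B(x1 - xs) = g + B(xk - xs). Expanding the squared dual norm of the
    left side, the cross term 2 a <F1, x1 - xs> yields 2 a d. *)
Lemma prox_step_energy (R : realType) n (B : 'M[R]_n) a delta d (xk x1 xs g F1 : 'rV[R]_n) :
  posdef B -> 0 < a -> normBd B g <= delta -> F1 = a^-1 *: (g - (x1 - xk) *m B) ->
  d <= pairing F1 (x1 - xs) ->
  2 * a * d + (a * normBd B F1) ^+ 2 + normB B (x1 - xs) ^+ 2 <= (normB B (xk - xs) + delta) ^+ 2.
Proof.
move=> hB a0 gd F1E dF.
have E : a *: F1 + (x1 - xs) *m B = g + (xk - xs) *m B.
  rewrite F1E scalerA divff ?gt_eqF// scale1r -addrA; congr (_ + _).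
  by rewrite -mulNmx -mulmxDl opprB addrA subrK.
have nE : normBd B (a *: F1 + (x1 - xs) *m B) <= normB B (xk - xs) + delta.
  rewrite E addrC [leRHS]addrC addrC; apply: le_trans (normBdD_le _ _ hB) _.
  by rewrite normBd_mulB// lerD2r.
have : normBd B (a *: F1 + (x1 - xs) *m B) ^+ 2 <= (normB B (xk - xs) + delta) ^+ 2.
  by rewrite lerXn2r ?nnegrE ?normBd_ge0// (le_trans _ nE) ?normBd_ge0.
apply: le_trans.
have -> : a * normBd B F1 = normBd B (a *: F1) by rewrite normBdZ// gtr0_norm.
rewrite !(normBd_normB _ hB) mulmxDl mulmxK ?posdef_unitmx//.
have := ler_wpM2l (ltW a0) dF; rewrite -pairingZl (pairing_ip _ _ hB).
move: (_ *m invmx B) (x1 - xs) => u y; rewrite !sqr_normB// !(ipDl, ipDr) (ipC y u hB); lra.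
Qed.

Lemma conv_on_add (R : realType) n (S U : set 'rV[R]_n) (f hr : 'rV[R]_n -> R) :
  S `<=` U -> conv_on U f -> conv_on S hr -> conv_on S (fun w => f w + hr w).
Proof.
move=> SU cU cS x y t Sx Sy t01; have [Sw hw] := cS x y t Sx Sy t01; split=> //.
have [_ fw] := cU x y t (SU _ Sx) (SU _ Sy) t01.
by apply: le_trans (lerD fw hw) _; lra.
Qed.

Lemma conv_on_average (R : realType) n (S : set 'rV[R]_n) (F : 'rV[R]_n -> R)
    (a : nat -> R) (x : nat -> 'rV[R]_n) k :
  conv_on S F -> (forall i, 0 < a i.+1) -> (forall i, S (x i)) -> (0 < k)%N ->
  let A := \sum_(1 <= i < k.+1) a i in
  let xbar := A^-1 *: \sum_(1 <= i < k.+1) a i *: x i in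
  S xbar /\ F xbar <= A^-1 * \sum_(1 <= i < k.+1) a i * F (x i).
Proof.
move=> cS a0 Sx; case: k => // k _; elim: k => [|k IH] A xbar.
  rewrite /xbar /A !big_nat1 scalerA mulVf ?gt_eqF// scale1r; split=> //.
  by rewrite mulrA mulVf ?mul1r// gt_eqF.
have [S1 F1] := IH.
set A1 := \sum_(1 <= i < k.+2) a i in S1 F1.
have A10 : 0 < A1 by rewrite /A1 big_nat_recr//= ltr_wpDl// big_add1/= sumr_ge0// => i _; exact: ltW.
have AE : A = A1 + a k.+2 by rewrite /A big_nat_recr.
have A0 : 0 < A by rewrite AE addr_gt0.
pose t := A1 / A.
have t01 : 0 <= t <= 1.
  apply/andP; split; first by apply: divr_ge0; exact: ltW.
  by rewrite ler_pdivrMr// mul1r AE lerDl ltW.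
have t1 : 1 - t = a k.+2 / A by rewrite /t AE; field; rewrite -AE gt_eqF.
have [S2 F2] := cS _ _ t S1 (Sx k.+2) t01.
have xE : xbar = t *: (A1^-1 *: \sum_(1 <= i < k.+2) a i *: x i) + (1 - t) *: x k.+2.
  rewrite /xbar [in LHS]big_nat_recr//= scalerDr t1 !scalerA; congr (_ *: _ + _ *: _).
    by rewrite /t mulrAC divff ?mul1r// gt_eqF.
  by rewrite mulrC.
rewrite xE; split=> //; apply: le_trans F2 _.
have tA : t / A1 = A^-1 by rewrite /t mulrAC divff ?mul1r// gt_eqF.
have H := ler_wpM2l (andP t01).1 F1; rewrite [leRHS]mulrA tA in H.
rewrite [in leRHS]big_nat_recr//= mulrDr t1.
by rewrite [A^-1 * (a k.+2 * _)]mulrCA [a k.+2 * (_ * _)]mulrA lerD2r.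
Qed.

(** If G increases, the step size decreases and [DS] applies. If G decreases, so does a_(i+1) G_i,
    since its (p+1)-th power is a constant times G_i. *)
Lemma step_size_grad_le (R : realType) p (Cp D : R) (a G : nat -> R) :
  0 < Cp -> (forall i, 0 < a i.+1) -> (forall i, 0 < G i) ->
  (forall i, a i.+1 ^+ p.+1 * (2 * G i) ^+ p = Cp) ->
  a 1%N * G 0%N <= D -> (forall i, a i.+1 * G i.+1 <= D) ->
  forall i, a i.+1 * G i <= D.
Proof.
move=> Cp0 a0 G0 aG D0 DS.
have ai i : 0 <= a i.+1 by exact: ltW.
have gi i : 0 <= G i by exact: ltW.
elim=> [//|i IH].
have [le_G|lt_G] := leP (G i) (G i.+1).
  apply: le_trans (DS i); rewrite ler_pM2r// -(@ler_pXn2r _ p.+1)// ?nnegrE//.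
  have q0 : 0 < (2 * G i.+1) ^+ p by rewrite exprn_gt0// mulr_gt0.
  rewrite -(ler_pM2r q0) aG -(aG i) ler_wpM2l ?exprn_ge0//.
  by rewrite lerXn2r ?nnegrE ?mulr_ge0// ler_pM2l.
apply: le_trans IH; rewrite -(@ler_pXn2r _ p.+1)// ?nnegrE ?mulr_ge0//.
have E j : (a j.+1 * G j) ^+ p.+1 = Cp / 2 ^+ p * G j.
  rewrite -(aG j) !exprMn [G j ^+ p.+1]exprS; field.
  by rewrite expf_neq0// pnatr_eq0.
by rewrite !E ler_pM2l ?(ltW lt_G)// divr_gt0// exprn_gt0.
Qed.

Lemma powR_step_size (R : realType) p (G C : R) : 0 < G -> 0 < C ->
  let a := powR (1 / (2 * G)) ((p.+1%:R - 1) / p.+1%:R) * powR C (p.+1%:R^-1) in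
  0 < a /\ a ^+ p.+1 * (2 * G) ^+ p = C.
Proof.
move=> G0 C0 a.
have G2 : 0 < 2 * G by rewrite mulr_gt0.
have iG : 0 < 1 / (2 * G) by rewrite divr_gt0.
have a0 : 0 < a by rewrite mulr_gt0 ?powR_gt0.
split=> //; rewrite /a exprMn.
have -> : powR (1 / (2 * G)) ((p.+1%:R - 1) / p.+1%:R) ^+ p.+1 = (2 * G) ^- p.
  rewrite -powR_mulrn ?powR_ge0// -powRrM divfK ?pnatr_eq0//.
  by rewrite -[p.+1%:R]natr1 addrK powR_mulrn ?(ltW iG)// div1r exprVn.
have -> : powR C (p.+1%:R^-1) ^+ p.+1 = C.
  by rewrite -powR_mulrn ?powR_ge0// -powRrM mulVf ?pnatr_eq0// powRr1// ltW.
by rewrite mulrAC mulVf ?mul1r// expf_neq0// gt_eqF.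
Qed.

(** * One run of the inner method *)

Section TensorInnerLoop.
Variables (R : realType) (n p : nat) (B : 'M[R]_n) (U S : set 'rV[R]_n).
Variables (f hr : 'rV[R]_n -> R) (L a : R) (xk Fpk : 'rV[R]_n) (z : nat -> 'rV[R]_n).
Hypotheses (hB : posdef B) (oU : open U) (fd : diffn p.+1 U f) (SU : S `<=` U).
Hypotheses (cU : conv_on U f) (cS : conv_on S hr) (L0 : 0 <= L) (a0 : 0 < a).
Hypothesis hL : forall y w : 'rV[R]_n, S y -> S w -> forall u : 'rV[R]_n, normB B u <= 1 ->
      `|Dk f u p.+1 y - Dk f u p.+1 w| <= L * normB B (y - w).
Hypotheses (z0 : z 0%N = xk) (Sz : forall t, S (z t)).
Hypothesis Fsub : forall w, S w -> f xk + hr xk + pairing Fpk (w - xk) <= f w + hr w.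
Hypothesis zmin : forall t,
  let M w := a * taylor p.+1 f (z t) w
     + (a * p.+1%:R * L) / (p.+2)`!%:R * normB B (w - z t) ^+ p.+2
     + 2^-1 * normB B (w - xk) ^+ 2 in
  forall w, S w -> M (z t.+1) + a * hr (z t.+1) <= M w + a * hr w.

Let g t := inner_grad p.+1 L B f a Fpk z t.

Lemma inner_grad_prox_subgrad t : prox_subgrad B S f hr a xk (z t) (g t).
Proof.
case: t => [|t]; last first.
  exact: (tensor_step_prox_subgrad hB oU fd SU cS (ltW a0) (Sz t) (Sz t.+1) (@zmin t)).
move=> y Sy; have Sx : S xk by rewrite -z0.
have fx : differentiable f xk by apply: (diffn_Dl (s := [::]) fd) => //; exact: SU.
have := subgradient_split cS Sx Sy fx Fsub.
rewrite /g /= z0 subrr mul0mx addr0 !(pairingDl, pairingNl, pairingZl) => H.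
have := ler_wpM2l (ltW a0) H; lra.
Qed.

Lemma inner_grad_contraction t :
  normBd B (g t.+1) <= a * (p.+2%:R * L / (p.+1)`!%:R) * normBd B (g t) ^+ p.+1.
Proof.
have seg (u : R) : 0 <= u <= 1 -> S (z t + u *: (z t.+1 - z t)).
  by move=> u01; have [] := conv_on_segment cS (Sz t) (Sz t.+1) u01.
apply: le_trans (tensor_grad_le hB oU fd SU L0 (ltW a0) seg hL) _.
apply: ler_wpM2l; first by rewrite !mulr_ge0 ?invr_ge0// ltW.
rewrite lerXn2r ?nnegrE ?normB_ge0 ?normBd_ge0//.
apply: (tensor_step_length hB oU fd SU cU L0 (ltW a0) seg hL (inner_grad_prox_subgrad t)).
exact: inner_grad_prox_subgrad t.+1.
Qed.

(** Dividing the proximal condition by a gives a subgradient of [hr]; the gradient inequality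
    restores f. This keeps F'(x_(k+1)) a subgradient of F. *)
Lemma inner_grad_subgradient t w : S w ->
  f (z t) + hr (z t) + pairing (a^-1 *: (g t - (z t - xk) *m B)) (w - z t) <= f w + hr w.
Proof.
move=> Sw.
have fz : differentiable f (z t) by apply: (diffn_Dl (s := [::]) fd) => //; exact: SU.
have := gradient_ineq cU (SU (Sz t)) (SU Sw) fz; rewrite -pairing_grad//.
have := inner_grad_prox_subgrad t Sw.
rewrite !(pairingDl, pairingNl, pairingZl) => H.
have ai : 0 <= a^-1 by rewrite invr_ge0 ltW.
have := mulr_ge0 ai H; rewrite !mulrDr !mulrA mulVf ?gt_eqF// !mul1r; lra.
Qed.

End TensorInnerLoop.

(** * From the extended-valued h to a real function on its domain *)

Lemma dom_fineE (R : realType) n (h : 'rV[R]_n -> \bar R) y :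
  proper_fun h -> dom h y -> h y = (fine (h y))%:E.
Proof.
by move=> [hN _] hy; rewrite fineK// fin_numE hN/= lt_eqF.
Qed.

Lemma dom_conv_on (R : realType) n (h : 'rV[R]_n -> \bar R) :
  proper_fun h -> convex_ext h -> conv_on (dom h) (fine \o h).
Proof.
move=> hp hc x y t Sx Sy t01.
have := hc x y t t01; rewrite (dom_fineE hp Sx) (dom_fineE hp Sy) -!EFinM -EFinD => H.
have Sw : dom h (t *: x + (1 - t) *: y) by apply: le_lt_trans H _; rewrite ltry.
by split=> //=; rewrite -lee_fin -dom_fineE.
Qed.

Lemma convex_conv_on (R : realType) n (U : set 'rV[R]_n) f :
  convex_setE U -> convex_on U f -> conv_on U f.
Proof. by move=> cU cf x y t Ux Uy t01; split; [exact: cU|exact: cf]. Qed.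

Lemma subdiff_fine (R : realType) n (f : 'rV[R]_n -> R) (h : 'rV[R]_n -> \bar R) x g :
  proper_fun h -> dom h x -> subdiff (Fsum f h) x g ->
  forall w, dom h w -> f x + fine (h x) + pairing g (w - x) <= f w + fine (h w).
Proof.
move=> hp Sx gs w Sw; have := gs w.
by rewrite /Fsum (dom_fineE hp Sx) (dom_fineE hp Sw) -!EFinD lee_fin.
Qed.

Lemma inner_argmin_dom (R : realType) n p (L : R) (B : 'M[R]_n) f (h : 'rV[R]_n -> \bar R)
    a xk zt z1 xs :
  proper_fun h -> 0 < a -> dom h xs ->
  (forall y, (inner_model p L B f h a xk zt z1 <= inner_model p L B f h a xk zt y)%E) ->
  dom h z1.
Proof.
move=> hp a0 Sxs /(_ xs); rewrite /inner_model (dom_fineE hp Sxs) -EFinM -EFinD => H.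
rewrite /dom /= ltNge; apply/negP; rewrite leye_eq => /eqP hz.
by move: H; rewrite hz gt0_muley ?lte_fin// addey// leye_eq.
Qed.

Lemma inner_argmin_fine (R : realType) n p (L : R) (B : 'M[R]_n) f (h : 'rV[R]_n -> \bar R)
    a xk zt z1 :
  proper_fun h -> dom h z1 ->
  (forall y, (inner_model p L B f h a xk zt z1 <= inner_model p L B f h a xk zt y)%E) ->
  let M w := a * taylor p f zt w + (a * p%:R * L) / (p.+1)`!%:R * normB B (w - zt) ^+ p.+1
     + 2^-1 * normB B (w - xk) ^+ 2 in
  forall w, dom h w -> M z1 + a * fine (h z1) <= M w + a * fine (h w).
Proof.
move=> hp Sz H M w Sw; have := H w.
by rewrite /inner_model (dom_fineE hp Sz) (dom_fineE hp Sw) -!EFinM -!EFinD lee_fin.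
Qed.
Theorem theorem6 (R : realType) (n p : nat) (B : 'M[R]_n)
  (f : 'rV[R]_n -> R) (h : 'rV[R]_n -> \bar R) (U : set 'rV[R]_n) (L : R)
  (xstar : 'rV[R]_n) (c s : R)
  (x : nat -> 'rV[R]_n) (Fp : nat -> 'rV[R]_n) (a : nat -> R)
  (z : nat -> nat -> 'rV[R]_n) (T : nat -> nat) (eps : R) (K : nat) :
  (2 <= p)%N ->
  posdef B ->
  proper_fun h -> closed_fun h -> convex_ext h ->
  open U -> convex_setE U -> dom h `<=` U ->
  convex_on U f -> diffn p U f ->
  0 < L ->
  (forall y w : 'rV[R]_n, dom h y -> dom h w ->
     forall u : 'rV[R]_n, normB B u <= 1 ->
       `|Dk f u p y - Dk f u p w| <= L * normB B (y - w)) ->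
  dom h xstar ->
  (forall y, (Fsum f h xstar <= Fsum f h y)%E) ->
  0 < c -> 1 < s ->
  (* the inexact proximal method *)
  dom h (x 0%N) ->
  subdiff (Fsum f h) (x 0%N) (Fp 0%N) ->
  (forall k, a k.+1 =
      powR (1 / (2 * normBd B (Fp k))) ((p%:R - 1) / p%:R)
      * powR (p`!%:R / ((p%:R + 1) * L)) (p%:R^-1)) ->
  (* inner method (RCTM) for Phi_{k+1}, started at z_0 = x_k *)
  (forall k, z k 0%N = x k) ->
  (forall k t y, (inner_model p L B f h (a k.+1) (x k) (z k t) (z k t.+1)
                  <= inner_model p L B f h (a k.+1) (x k) (z k t) y)%E) ->
  (* T k = first t with ||Phi'_{k+1}(z_t)||_* <= delta_{k+1} = c/(k+1)^s *)
  (forall k, normBd B (inner_grad p L B f (a k.+1) (Fp k) (z k) (T k))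
               <= c / powR (k.+1)%:R s) ->
  (forall k t, (t < T k)%N ->
     c / powR (k.+1)%:R s < normBd B (inner_grad p L B f (a k.+1) (Fp k) (z k) t)) ->
  (forall k, x k.+1 = z k (T k)) ->
  (forall k, Fp k.+1 = (a k.+1)^-1 *:
       (inner_grad p L B f (a k.+1) (Fp k) (z k) (T k) - (x k.+1 - x k) *m B)) ->
  (forall i, Fp i != 0) ->
  0 < eps ->
  (forall k, (1 <= k <= K)%N -> (Fsum f h (x k) >= (fine (Fsum f h xstar) + eps)%:E)%E) ->
  let Fstar := fine (Fsum f h xstar) in
  let Rc := normB B (x 0%N - xstar) + c * s / (s - 1) in
  let D := Num.max Rc
     (powR (p`!%:R * normBd B (Fp 0%N) / ((p%:R + 1) * L * 2 ^+ p.-1)) (p%:R^-1)) in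
  let xbar k := (\sum_(1 <= i < k.+1) a i)^-1 *: \sum_(1 <= i < k.+1) a i *: x i in
  let N k := (\sum_(j < k) T j)%N in
  forall k : nat, (1 <= k)%N ->
    ln (normBd B (Fp 0%N) * Rc / eps) <= k%:R -> (k <= K)%N ->
    (Fsum f h (xbar k) <= (Fstar + L * Rc ^+ p.+1 / powR k%:R ((p%:R + 1) / 2)
         * ((p%:R + 1) * 2 ^+ (p - 2) * expR (p%:R - 1) / p`!%:R))%:E)%E
    /\ (N k)%:R <= k%:R * (1 + (log2 p%:R)^-1 * log2 (log2 (2 * D * powR k%:R s / c))).

Proof.
move=> p2 hB hp _ hc oU cvU SU cvf fd L0 hL Sxs xsmin c0 s1 Sx0 sub0 aE z0 zargmin Tle Tgt xS FpS Fp0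
  eps0 Feps Fstar Rc D xbar N k k0 kln kK.
(* From here on the degree is [p.+2]. *)
case: p p2 fd hL aE zargmin Tle Tgt FpS @D => [//|[//|p]] _ fd hL aE zargmin Tle Tgt FpS D.
set S := dom h in SU hL Sxs Sx0.
pose hr : 'rV[R]_n -> R := fine \o h.
have cS : conv_on S hr by exact: dom_conv_on.
have cU : conv_on U f by exact: convex_conv_on.
have FE y : S y -> Fsum f h y = (f y + hr y)%:E by move=> Sy; rewrite /Fsum (dom_fineE hp Sy).
have FsE : Fstar = f xstar + hr xstar by rewrite /Fstar FE.
have Fmin w : S w -> Fstar <= f w + hr w.
  by move=> Sw; have := xsmin w; rewrite !FE// lee_fin FsE.
pose G k := normBd B (Fp k).
have G0 i : 0 < G i by exact: normBd_gt0.
pose Cp : R := p.+2`!%:R / ((p.+2%:R + 1) * L).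
have f0 m : 0 < m`!%:R :> R by rewrite ltr0n fact_gt0.
have Cp0 : 0 < Cp by rewrite divr_gt0// mulr_gt0// addr_gt0.
have aP i : 0 < a i.+1 /\ a i.+1 ^+ p.+2 * (2 * G i) ^+ p.+1 = Cp.
  by rewrite aE; exact: (powR_step_size p.+1 (G0 i) Cp0).
have a0 i : 0 < a i.+1 by case: (aP i).
have aG i : a i.+1 ^+ p.+2 * (2 * G i) ^+ p.+1 = Cp by case: (aP i).
have SzS i t : S (z i t.+1).
  by apply: (inner_argmin_dom hp (a0 i) Sxs); exact: zargmin.
have Sx i : S (x i).
  by elim: i => // i IH; rewrite xS; case: (T i) => [|t]; rewrite ?z0.
have Sz i t : S (z i t) by case: t => [|t]; rewrite ?z0.
have zmin i t := inner_argmin_fine hp (SzS i t) (zargmin i t).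
(* Induction is forced: the inner run i starts from a_(i+1) F'(x_i), which must come from a
   subgradient for its later gradients to yield one. *)
have Fsub i : forall w, S w -> f (x i) + hr (x i) + pairing (Fp i) (w - x i) <= f w + hr w.
  elim: i => [|i IH] w Sw; first exact: (subdiff_fine hp Sx0 sub0).
  rewrite FpS xS.
  exact: (inner_grad_subgradient hB oU fd SU cU cS (a0 i) (z0 i) (Sz i) IH (zmin i)).
pose delta i : R := c / powR i%:R s.
have delta0 i : 0 <= delta i by rewrite divr_ge0 ?powR_ge0// ltW.
pose rho i := normB B (x i - xstar).
pose e i := 2 * a i * (f (x i) + hr (x i) - Fstar) + (a i * G i) ^+ 2.
have Fle i : f (x i) + hr (x i) - Fstar <= pairing (Fp i) (x i - xstar).
  by have := Fsub i _ Sxs; rewrite -opprB pairingNr FsE; lra.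
have gap0 i : 0 <= 2 * a i.+1 * (f (x i.+1) + hr (x i.+1) - Fstar).
  by rewrite !mulr_ge0 ?(ltW (a0 i))// subr_ge0 Fmin.
have e0 i : 0 <= e i.+1 by rewrite addr_ge0// sqr_ge0.
have estep i : e i.+1 + rho i.+1 ^+ 2 <= (rho i + delta i.+1) ^+ 2.
  exact: (prox_step_energy hB (a0 i) (Tle i) (FpS i) (Fle i.+1)).
have energy m := energy_sum m (fun i => normB_ge0 B (x i - xstar)) delta0 e0 estep.
have Rc0 : 0 < Rc.
  by rewrite /Rc ltr_wpDl ?normB_ge0// divr_gt0 ?subr_gt0// mulr_gt0// (lt_trans ltr01).
have sumdelta m : rho 0%N + \sum_(1 <= i < m.+1) delta i <= Rc.
  rewrite /Rc lerD2l -mulrA; apply: le_trans (ler_wpM2l (ltW c0) (sum_powR_le m s1)).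
  by rewrite mulr_sumr; apply: ler_sum => i _; rewrite /delta powRN.
have energyR m : \sum_(1 <= i < m.+1) e i + rho m ^+ 2 <= Rc ^+ 2.
  apply: le_trans (energy m) _; rewrite lerXn2r ?nnegrE ?(ltW Rc0)//.
  by rewrite addr_ge0 ?normB_ge0 ?sumr_ge0.
have sume0 m : 0 <= \sum_(1 <= i < m.+1) e i by rewrite big_add1 sumr_ge0.
have rhoR m : rho m <= Rc.
  rewrite -(@ler_pXn2r _ 2)// ?nnegrE ?normB_ge0 ?(ltW Rc0)//.
  by have := energyR m; have := sume0 m; lra.
have aGR i : a i.+1 * G i.+1 <= Rc.
  rewrite -(@ler_pXn2r _ 2)// ?nnegrE ?mulr_ge0 ?(ltW (a0 i)) ?(ltW (G0 _)) ?(ltW Rc0)//.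
  have := energyR i.+1; rewrite big_nat_recr//= /e.
  have := sume0 i; have := gap0 i; have := sqr_ge0 (rho i.+1); lra.
split.
- have [Sxb Fxb] := conv_on_average (conv_on_add SU cU cS) a0 Sx k0.
  rewrite FE// lee_fin; apply: le_trans Fxb _.
  set A := \sum_(1 <= i < k.+1) a i.
  have sums : \sum_(1 <= i < k.+1) e i =
      2 * (\sum_(1 <= i < k.+1) a i * (f (x i) + hr (x i)) - A * Fstar) +
      \sum_(1 <= i < k.+1) (a i * G i) ^+ 2.
    rewrite /e big_split/=; congr (_ + _).
    rewrite /A mulr_suml -sumrB mulr_sumr; apply: eq_bigr => i _; ring.
  have aGsum : \sum_(1 <= i < k.+1) (a i * G i) ^+ 2 <= Rc ^+ 2.
    apply: le_trans (energyR k); rewrite ler_wpDr ?sqr_ge0// 2!big_add1/=.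
    by apply: ler_sum => i _; rewrite /e lerDr.
  (* eps <= F(x_k) - F_star <= G_k |x_k - x_star| <= G_k Rc, hence G_0 / G_k <= G_0 Rc / eps. *)
  have Gk : ln (G 0%N) - ln (G k) <= k%:R.
    apply: le_trans kln; rewrite -/(G 0%N) -mulrA lnM ?posrE ?divr_gt0// lerD2l.
    rewrite lerNl -lnV ?posrE ?divr_gt0// invf_div ler_ln ?posrE ?divr_gt0//.
    rewrite ler_pdivrMr//.
    have := Feps k; rewrite k0 kK -/Fstar (FE _ (Sx k)) lee_fin => /(_ erefl) Fk.
    have := le_trans (Fle k) (le_trans (ler_norm _) (pairing_le (Fp k) _ hB)).
    have := ler_wpM2l (ltW (G0 k)) (rhoR k); rewrite /rho -/(G k); lra.
  have Alow := step_size_sum (ltn0Sn p) k0 Cp0 Rc0 a0 G0 aG aGsum Gk.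
  have kR : 0 < k%:R :> R by rewrite ltr0n.
  set K1 := powR k%:R _ in Alow *.
  have K10 : 0 < K1 by exact: powR_gt0.
  set W := K1 * Cp / _ in Alow.
  have W0 : 0 < W by apply: divr_gt0; [exact: mulr_gt0|apply: exprn_gt0; rewrite !mulr_gt0// expR_gt0].
  have A0 : 0 < A := lt_le_trans W0 Alow.
  have gap : A^-1 * \sum_(1 <= i < k.+1) a i * (f (x i) + hr (x i)) - Fstar <= Rc ^+ 2 / 2 / A.
    rewrite ler_pdivlMr// mulrBl mulrAC mulVf ?gt_eqF// mul1r [Fstar * A]mulrC ler_pdivlMr//.
    have := energyR k; have := sqr_ge0 (rho k).
    have : 0 <= \sum_(1 <= i < k.+1) (a i * G i) ^+ 2 by rewrite sumr_ge0// => i _; exact: sqr_ge0.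
    rewrite sums; lra.
  rewrite -lerBlDl; apply: le_trans gap _.
  have : Rc ^+ 2 / 2 / A <= Rc ^+ 2 / 2 / W.
    by rewrite ler_wpM2l ?divr_ge0 ?sqr_ge0// lef_pV2.
  move=> /le_trans; apply; rewrite le_eqVlt; apply/orP; left; apply/eqP.
  have -> : expR (p.+2%:R - 1) = expR 1 ^+ p.+1 :> R.
    by rewrite -[p.+2%:R]natr1 addrK -expRM_natl mulr1.
  rewrite subn2/= /W /Cp !exprMn !exprS.
  have p30 : (p.+2%:R + 1 : R) != 0 by rewrite natr1 pnatr_eq0.
  field.
  by rewrite !gt_eqF ?expR_gt0 ?exprn_gt0 ?expR_gt0//=.
- have D0 : a 1%N * G 0%N <= D.
    (* Identifies the second entry of [D] as exactly a_1 G_0. *)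
    have E : (a 1%N * G 0%N) ^+ p.+2 = p.+2`!%:R * G 0%N / ((p.+2%:R + 1) * L * 2 ^+ p.+1).
      have <- : Cp / 2 ^+ p.+1 * G 0%N = p.+2`!%:R * G 0%N / ((p.+2%:R + 1) * L * 2 ^+ p.+1).
        rewrite /Cp; field; rewrite !gt_eqF ?exprn_gt0//=.
      rewrite -(aG 0%N) !exprMn [G 0%N ^+ p.+2]exprS; field.
      by rewrite expf_neq0// pnatr_eq0.
    rewrite /D le_max; apply/orP; right; rewrite -/(G 0%N) -E -powR_mulrn; last first.
      by rewrite mulr_ge0// ltW.
    by rewrite -powRrM divff ?pnatr_eq0// powRr1// mulr_ge0// ltW.
  have DS i : a i.+1 * G i.+1 <= D by rewrite /D le_max aGR.
  have aGD := step_size_grad_le Cp0 a0 G0 aG D0 DS.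
  have kR : 0 < k%:R :> R by rewrite ltr0n.
  set X := 2 * D * powR k%:R s / c.
  have DR : Rc <= D by rewrite /D le_max lexx.
  (* Since s/(s-1) > 1; this gives D > c and thus X > 2, so that the iterated logarithm is
     positive. *)
  have cR : c < Rc.
    rewrite /Rc ltr_wpDl ?normB_ge0// -mulrA ltr_pMr// ltr_pdivlMr ?subr_gt0// mul1r; lra.
  have k1 : 1 <= powR k%:R s.
    by rewrite -[leLHS](powRr0 k%:R) ler_powR ?ler1n// ltW// (lt_trans ltr01).
  have X2 : 2 < X.
    rewrite /X ltr_pdivlMr//.
    have D00 : c < D := lt_le_trans cR DR.
    have := ler_wpM2l (ltW (lt_trans c0 D00)) k1; lra.
  have Tk (i : 'I_k) : (T i)%:R <= 1 + (log2 p.+2%:R)^-1 * log2 (log2 X).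
    pose g t := normBd B (inner_grad p.+2 L B f (a i.+1) (Fp i) (z i) t).
    have gc t : g t.+1 <= a i.+1 * Cp^-1 * g t ^+ p.+2.
      (* The constant of the step-size rule is the inverse of the contraction constant. *)
      have -> : Cp^-1 = p.+3%:R * L / p.+2`!%:R by rewrite /Cp invf_div natr1.
      exact: (inner_grad_contraction hB oU fd SU cU cS (ltW L0) (a0 i) hL (z0 i) (Sz i) (Fsub i) (zmin i)).
    have gd := @superlinear_decay R (a i.+1) (G i) Cp^-1 p.+1 g (ltW (a0 i)) _ (fun t => normBd_ge0 B _) _ gc _.
    have {}gd t : g t <= 2 * a i.+1 * G i * 2^-1 ^+ (p.+2 ^ t).
      apply: gd; first by rewrite invr_ge0 ltW.
        by rewrite /g /= normBdZ// gtr0_norm.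
      by rewrite aG divff// gt_eqF.
    have di : 0 < c / powR i.+1%:R s by rewrite divr_gt0// powR_gt0.
    apply: (superlinear_count gd di X2 _ (Tgt i)).
    (* One [X] serves all runs i < k: a_(i+1) G_i <= D, and i+1 <= k makes the last tolerance the
       smallest. *)
    rewrite /X invf_div !mulrA ler_pM2r ?invr_gt0//.
    apply: ler_pM; rewrite ?powR_ge0 ?mulr_ge0 ?(ltW (a0 i)) ?(ltW (G0 i))//.
      by rewrite -mulrA ler_pM2l.
    by rewrite ge0_ler_powR ?nnegrE ?ler_nat// ltW// (lt_trans ltr01).
  rewrite /N natr_sum; apply: le_trans (ler_sum _ (fun i _ => Tk i)) _.
  by rewrite sumr_const card_ord mulr_natl.
Qed.
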